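(* Let $\mathcal D$ be a $K$-linear, Krull–Schmidt, Hom-finite triangulated category (over a field $K$), let $S=\bigoplus_{i=1}^nS_i$ be a basic silting object in $\mathcal D$, and let $U$ be a basic presilting object in $\mathcal C=S\ast S[1]$. Let $M=\bigoplus_{i=1}^n M_i$ be a basic silting object in $\mathcal C$ and $N$ a left mutation of $M$ with $N$ still in $\mathcal C$ (the $S_i$ and $M_i$ being indecomposable). Suppose that $\mathrm{Hom}_{\mathcal D}(U,M[i])=0$ for every positive integer $i$ (equivalently, $\mathrm{Hom}_{\mathcal D}(U,M[1])=0$). Then the following statements hold. (i) $\mathrm{Hom}_{\mathcal D}(U,N[i])=0$ for every positive integer $i$. (ii) $B_U^-(M)$ and $B_U^-(N)$ are basic silting objects in $\mathcal C$. (iii) Either $B_U^-(N)$ equals $B_U^-(M)$ or $B_U^-(N)$ is a left mutation of $B_U^-(M)$.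
   Context: An object $V\in\mathcal D$ is presilting if $\mathrm{Hom}_{\mathcal D}(V,V[i])=0$ for all $i>0$; a presilting object $S$ is silting if $\mathcal D=\mathsf{thick}(S)$, the smallest thick subcategory containing $S$. A (pre)silting object in $\mathcal C$ means a (pre)silting object of $\mathcal D$ that belongs to $\mathcal C$; objects are considered up to isomorphism. Any two basic silting objects of $\mathcal D$ have the same number $n$ of indecomposable direct summands. $S\ast S[1]$ is the full subcategory of objects $Z\in\mathcal D$ admitting a triangle $X\to Z\to Y\to X[1]$ with $X\in\mathsf{add}\,S$ and $Y\in\mathsf{add}(S[1])$. For an object $X$, $\mathsf{add}\,X$ is its additive closure, and $X^\flat$ denotes the basic object corresponding to $X$ (the direct sum of one copy of each indecomposable direct summand of $X$ up to isomorphism). A left $\mathsf{add}\,U$-approximation of $C$ is a morphism $C\to U'$ with $U'\in\mathsf{add}\,U$ through which every morphism from $C$ to an object of $\mathsf{add}\,U$ factors; it is minimal if it is left minimal (it has no direct summand of the form $0\to U''$ with $U''\neq0$). Left mutation: for a basic silting object $M=\bigoplus_{i=1}^nM_i$ and $k\in\{1,\dots,n\}$, put $L=\bigoplus_{i\ne k}M_i$ and take a triangle $M_k\xrightarrow{f}L'\to Z\to M_k[1]$ with $f$ a minimal left $\mathsf{add}\,L$-approximation; then $(L\oplus Z)^\flat$ is a basic silting object, called the left mutation of $M$ at $M_k$. A left mutation of $M$ is a left mutation at some $M_k$. For basic objects $U,T$ in $\mathcal D$, take a triangle $T[-1]\xrightarrow{f}U'\to X_U\to T$ with $f$ a minimal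 left $\mathsf{add}\,U$-approximation of $T[-1]$; set $B_U^-(T):=(U\oplus X_U)^\flat$. *)

(* Defs.v *)
From mathcomp Require Import all_boot all_order all_algebra.

Set Implicit Arguments.
Unset Strict Implicit.
Unset Printing Implicit Defensive.

Import GRing.Theory.
Local Open Scope ring_scope.

(* Hom-finiteness is built in: Hom-spaces are finite-dimensional K-spaces.    *)
Record linCategory (K : fieldType) : Type := LinCategory {
  ob :> Type;
  mor : ob -> ob -> vectType K;
  idm : forall X, mor X X;
  compm : forall X Y Z, mor Y Z -> mor X Y -> mor X Z;
  comp_idl : forall X Y (f : mor X Y), compm (idm Y) f = f;
  comp_idr : forall X Y (f : mor X Y), compm f (idm X) = f;
  compmA : forall W X Y Z (h : mor Y Z) (g : mor X Y) (f : mor W X),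
    compm h (compm g f) = compm (compm h g) f;
  comp_linear_l : forall X Y Z (a : K) (g g' : mor Y Z) (f : mor X Y),
    compm (a *: g + g') f = a *: compm g f + compm g' f;
  comp_linear_r : forall X Y Z (a : K) (g : mor Y Z) (f f' : mor X Y),
    compm g (a *: f + f') = a *: compm g f + compm g f'
}.

Notation "g \oc f" := (compm g f) (at level 40, left associativity).

Section LinearCategory.
Variables (K : fieldType) (C : linCategory K).
Implicit Types A B X Y Z : C.

Definition is_iso X Y (f : mor X Y) : Prop :=
  exists g : mor Y X, g \oc f = idm X /\ f \oc g = idm Y.

Definition isomorphic X Y : Prop := exists f : mor X Y, is_iso f.

Definition is_zero X : Prop := idm X = 0.

Definition hom_vanishes X Y : Prop := forall f : mor X Y, f = 0.

Record biproduct A B Y (i1 : mor A Y) (i2 : mor B Y)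
    (p1 : mor Y A) (p2 : mor Y B) : Prop := Biproduct {
  biprod11 : p1 \oc i1 = idm A;
  biprod22 : p2 \oc i2 = idm B;
  biprod12 : p1 \oc i2 = 0;
  biprod21 : p2 \oc i1 = 0;
  biprod_sum : i1 \oc p1 + i2 \oc p2 = idm Y
}.

Definition is_dsum2 A B Y : Prop :=
  exists (i1 : mor A Y) (i2 : mor B Y) (p1 : mor Y A) (p2 : mor Y B),
    biproduct i1 i2 p1 p2.

(* Y is a direct sum of the family X; the empty direct sums are the zero      *)
(* objects.                                                                   *)
Definition is_dsum (I : finType) (X : I -> C) Y : Prop :=
  exists (inj : forall i, mor (X i) Y) (proj : forall i, mor Y (X i)),
    [/\ forall i, proj i \oc inj i = idm (X i),
        forall i j, i != j -> proj j \oc inj i = 0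
      & \sum_i (inj i \oc proj i) = idm Y].

Definition summand X Y : Prop := exists X', is_dsum2 X X' Y.

Definition indecomposable X : Prop :=
  ~ is_zero X /\ forall A B, is_dsum2 A B X -> is_zero A \/ is_zero B.

(* The endomorphism ring of X is local: it is nonzero and its non-invertible  *)
(* elements are closed under addition.                                        *)
Definition local_end X : Prop :=
  ~ is_zero X /\
  forall f g : mor X X, ~ is_iso f -> ~ is_iso g -> ~ is_iso (f + g).

Definition krull_schmidt : Prop :=
  forall X, exists (n : nat) (Z : 'I_n -> C),
    is_dsum Z X /\ forall i, local_end (Z i).

(* in_add S X : X belongs to add S.                                           *)
Definition in_add (S X : C) : Prop :=
  exists (n : nat) (Y : C), is_dsum (fun _ : 'I_n => S) Y /\ summand X Y.

Definition basic_decomp (n : nat) (Z : 'I_n -> C) X : Prop :=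
  [/\ forall i, indecomposable (Z i),
      forall i j, i != j -> ~ isomorphic (Z i) (Z j)
    & is_dsum Z X].

Definition basic X : Prop := exists (n : nat) (Z : 'I_n -> C), basic_decomp Z X.

(* is_flat X Y : Y is X^flat, the basic object corresponding to X.            *)
Definition is_flat X Y : Prop :=
  exists (n : nat) (Z : 'I_n -> C),
    [/\ basic_decomp Z Y,
        forall i, summand (Z i) X
      & forall W, indecomposable W -> summand W X ->
          exists i, isomorphic W (Z i)].

Definition left_approx (U : C) X U' (f : mor X U') : Prop :=
  in_add U U' /\
  forall V, in_add U V -> forall g : mor X V, exists h : mor U' V, h \oc f = g.

(* f has no direct summand 0 -> U2 with U2 nonzero.                           *)
Definition left_minimal X U' (f : mor X U') : Prop :=
  forall U1 U2 (i1 : mor U1 U') (i2 : mor U2 U')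
      (p1 : mor U' U1) (p2 : mor U' U2),
    biproduct i1 i2 p1 p2 -> p2 \oc f = 0 -> is_zero U2.

Definition min_left_approx (U : C) X U' (f : mor X U') : Prop :=
  left_approx U f /\ left_minimal f.

End LinearCategory.

(* The suspension is an autoequivalence, not necessarily an automorphism:     *)
(* it is fully faithful and unsh X is a chosen object with                    *)
(* sh (unsh X) isomorphic to X.                                               *)
Record triCategory (K : fieldType) : Type := TriCategory {
  tri_lin :> linCategory K;
  has_dsums : forall (n : nat) (X : 'I_n -> tri_lin), exists Y, is_dsum X Y;
  sh : tri_lin -> tri_lin;
  shm : forall X Y : tri_lin, mor X Y -> mor (sh X) (sh Y);
  shm_id : forall X : tri_lin, shm (idm X) = idm (sh X);
  shm_comp : forall (X Y Z : tri_lin) (g : mor Y Z) (f : mor X Y),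
    shm (g \oc f) = shm g \oc shm f;
  shm_linear : forall (X Y : tri_lin) (a : K) (f g : mor X Y),
    shm (a *: f + g) = a *: shm f + shm g;
  shm_bij : forall X Y : tri_lin, bijective (@shm X Y);
  unsh : tri_lin -> tri_lin;
  sh_unsh : forall X : tri_lin, isomorphic (sh (unsh X)) X;
  (* dist f g h : X -f-> Y -g-> Z -h-> X[1] is a distinguished triangle       *)
  dist : forall X Y Z : tri_lin, mor X Y -> mor Y Z -> mor Z (sh X) -> Prop;
  dist_iso : forall (X Y Z X' Y' Z' : tri_lin)
      (f : mor X Y) (g : mor Y Z) (h : mor Z (sh X))
      (f' : mor X' Y') (g' : mor Y' Z') (h' : mor Z' (sh X'))
      (a : mor X X') (b : mor Y Y') (c : mor Z Z'),
    is_iso a -> is_iso b -> is_iso c ->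
    b \oc f = f' \oc a -> c \oc g = g' \oc b -> shm a \oc h = h' \oc c ->
    dist f g h -> dist f' g' h';
  dist_id : forall X O : tri_lin, is_zero O ->
    dist (idm X) (0 : mor X O) (0 : mor O (sh X));
  dist_cone : forall (X Y : tri_lin) (f : mor X Y),
    exists (Z : tri_lin) (g : mor Y Z) (h : mor Z (sh X)), dist f g h;
  dist_rot : forall (X Y Z : tri_lin)
      (f : mor X Y) (g : mor Y Z) (h : mor Z (sh X)),
    dist f g h <-> dist g h (- shm f);
  dist_mor : forall (X Y Z X' Y' Z' : tri_lin)
      (f : mor X Y) (g : mor Y Z) (h : mor Z (sh X))
      (f' : mor X' Y') (g' : mor Y' Z') (h' : mor Z' (sh X'))
      (a : mor X X') (b : mor Y Y'),
    dist f g h -> dist f' g' h' -> b \oc f = f' \oc a ->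
    exists c : mor Z Z', c \oc g = g' \oc b /\ shm a \oc h = h' \oc c;
  dist_octahedral : forall (X Y Z X' Y' Z' : tri_lin)
      (f : mor X Y) (f1 : mor Y Z') (f2 : mor Z' (sh X))
      (g : mor Y Z) (g1 : mor Z X') (g2 : mor X' (sh Y))
      (h1 : mor Z Y') (h2 : mor Y' (sh X)),
    dist f f1 f2 -> dist g g1 g2 -> dist (g \oc f) h1 h2 ->
    exists (u : mor Z' Y') (v : mor Y' X'),
      dist u v (shm f1 \oc g2) /\
      [/\ u \oc f1 = h1 \oc g, h2 \oc u = f2,
          v \oc h1 = g1 & g2 \oc v = shm f \oc h2]
}.

Section Silting.
Variables (K : fieldType) (D : triCategory K).
Implicit Types A B X Y Z : D.

(* X[i] for i : nat.                                                          *)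
Definition shn (i : nat) X : D := iter i (@sh K D) X.

Definition presilting (V : D) : Prop :=
  forall i : nat, (0 < i)%N -> hom_vanishes V (shn i V).

(* P is the class of objects of a thick subcategory. Closure under            *)
(* isomorphism is a special case of closure under summands.                   *)
Record thick_subcat (P : D -> Prop) : Prop := ThickSubcat {
  thick_zero : forall O : D, is_zero O -> P O;
  thick_sh : forall X, P X <-> P (sh X);
  thick_cone : forall X Y Z (f : mor X Y) (g : mor Y Z) (h : mor Z (sh X)),
    dist f g h -> P X -> P Y -> P Z;
  thick_summand : forall X Y, summand X Y -> P Y -> P X
}.

Definition thick (S X : D) : Prop :=
  forall P : D -> Prop, thick_subcat P -> P S -> P X.

Definition silting (S : D) : Prop := presilting S /\ forall X, thick S X.

(* two_term S Z : Z belongs to S * S[1].                                      *)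
Definition two_term (S Z : D) : Prop :=
  exists (X Y : D) (f : mor X Z) (g : mor Z Y) (h : mor Y (sh X)),
    [/\ in_add S X, in_add (sh S) Y & dist f g h].

Definition left_mutation_at (n : nat) (Mi : 'I_n -> D) (k : 'I_n) (N : D) :
    Prop :=
  exists L L' Z E : D,
  exists (f : mor (Mi k) L') (g : mor L' Z) (h : mor Z (sh (Mi k))),
    [/\ is_dsum (fun i : {i : 'I_n | i != k} => Mi (val i)) L,
        min_left_approx L f,
        dist f g h,
        is_dsum2 L Z E
      & is_flat E N].

(* N is a left mutation of the basic silting object M.                        *)
Definition left_mutation (M N : D) : Prop :=
  silting M /\
  exists (n : nat) (Mi : 'I_n -> D),
    basic_decomp Mi M /\ exists k : 'I_n, left_mutation_at Mi k N.

(* is_Bminus U T B : B is B_U^-(T), which is defined up to isomorphism only.  *)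
(* The third map of the triangle is written with target T[-1][1], which is    *)
(* isomorphic to T.                                                           *)
Definition is_Bminus (U T B : D) : Prop :=
  exists U' XU E : D,
  exists (f : mor (unsh T) U') (g : mor U' XU) (h : mor XU (sh (unsh T))),
    [/\ min_left_approx U f,
        dist f g h,
        is_dsum2 U XU E
      & is_flat E B].

Definition basic_silting_in (S B : D) : Prop :=
  [/\ basic B, silting B & two_term S B].

End Silting.

(* Main.v *)
Require Import Defs.
From HB Require Import structures.
From mathcomp Require Import all_boot all_order all_algebra.
From Stdlib Require Import Classical.

(* Both B_U^-(T) and left mutation arise from a triangle U' -> X -> T -> U'[1]
   with U' in add U and Hom(X, U[1]) = 0, where T = M_k[1] and U = L for the
   mutation of M = L + M_k. Such a universal extension of T is unique up to
   add U, because maps into X are detected, modulo add U, on T.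

   A silting object is maximal: an object without positive extensions to and
   from M lies in add M. So two silting objects have the same additive closure
   as soon as one of them has no positive extensions to and from the other,
   which gives all the comparisons below.

   Let X_L and X_k be universal extensions of L and M_k by U, let
   P = add (U + X_L), and take a minimal left add M-approximation triangle
   U -> M^0 -> M^1 -> U[1]; M^1 is in add M by maximality. As Hom(U, U[1]) = 0,
   M^0 and M^1 have no common indecomposable summand. If M_k is not a summand
   of M^0, every map U -> M_k factors through add L and End(X_k)/[P] is trivial
   or local, because it is controlled by the local ring End(M_k). If M_k is a
   summand of M^0, then M^1 is in add L and X_k is in P. So B_U^-(M) has at most
   one indecomposable summand outside P. If it has none, B_U^-(M) belongs to
   add B_U^-(N) and the two are equal; otherwise B_U^-(N) is compared with the
   left mutation at that summand, using that every map from it to B_U^-(N)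
   factors through P. *)

Set Implicit Arguments.
Unset Strict Implicit.
Unset Printing Implicit Defensive.

Import GRing.Theory.
Local Open Scope ring_scope.

(** * Linear categories: factorization ideals, additive closures, local objects *)

Section LinearCategory.
Variables (K : fieldType) (C : linCategory K).
Implicit Types (A B W X Y Z : C) (Q : C -> Prop).

Lemma compDl X Y Z (g g' : mor Y Z) (f : mor X Y) :
  (g + g') \oc f = g \oc f + g' \oc f.
Proof. by have := comp_linear_l 1 g g' f; rewrite !scale1r. Qed.

Lemma compDr X Y Z (g : mor Y Z) (f f' : mor X Y) :
  g \oc (f + f') = g \oc f + g \oc f'.
Proof. by have := comp_linear_r 1 g f f'; rewrite !scale1r. Qed.

Lemma comp0l X Y Z (f : mor X Y) : (0 : mor Y Z) \oc f = 0.
Proof. by apply: (addrI (0 \oc f)); rewrite -compDl !addr0. Qed.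

Lemma comp0r X Y Z (g : mor Y Z) : g \oc (0 : mor X Y) = 0.
Proof. by apply: (addrI (g \oc 0)); rewrite -compDr !addr0. Qed.

Lemma compZl X Y Z a (g : mor Y Z) (f : mor X Y) :
  (a *: g) \oc f = a *: (g \oc f).
Proof. by have := comp_linear_l a g 0 f; rewrite comp0l !addr0. Qed.

Lemma compZr X Y Z a (g : mor Y Z) (f : mor X Y) :
  g \oc (a *: f) = a *: (g \oc f).
Proof. by have := comp_linear_r a g f 0; rewrite comp0r !addr0. Qed.

Lemma compNl X Y Z (g : mor Y Z) (f : mor X Y) : (- g) \oc f = - (g \oc f).
Proof. by rewrite -scaleN1r compZl scaleN1r. Qed.

Lemma compNr X Y Z (g : mor Y Z) (f : mor X Y) : g \oc (- f) = - (g \oc f).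
Proof. by rewrite -scaleN1r compZr scaleN1r. Qed.

Lemma compBl X Y Z (g g' : mor Y Z) (f : mor X Y) :
  (g - g') \oc f = g \oc f - g' \oc f.
Proof. by rewrite compDl compNl. Qed.

Lemma compBr X Y Z (g : mor Y Z) (f f' : mor X Y) :
  g \oc (f - f') = g \oc f - g \oc f'.
Proof. by rewrite compDr compNr. Qed.

Lemma comp_suml (I : finType) X Y Z (F : I -> mor Y Z) (f : mor X Y) :
  (\sum_i F i) \oc f = \sum_i (F i \oc f).
Proof.
by elim/big_rec2: _ => [|i u v _ <-]; rewrite ?comp0l ?compDl.
Qed.

Lemma comp_sumr (I : finType) X Y Z (g : mor Y Z) (F : I -> mor X Y) :
  g \oc (\sum_i F i) = \sum_i (g \oc F i).
Proof.
by elim/big_rec2: _ => [|i u v _ <-]; rewrite ?comp0r ?compDr.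
Qed.

Lemma is_iso_id X : is_iso (idm X).
Proof. by exists (idm X); rewrite comp_idl. Qed.

Lemma isomorphic_refl X : isomorphic X X.
Proof. by exists (idm X); apply: is_iso_id. Qed.

Lemma isomorphic_sym X Y : isomorphic X Y -> isomorphic Y X.
Proof. by case=> f [g [gf fg]]; exists g, f. Qed.

Lemma isomorphic_trans X Y Z :
  isomorphic X Y -> isomorphic Y Z -> isomorphic X Z.
Proof.
move=> [f [f' [f'f ff']]] [g [g' [g'g gg']]]; exists (g \oc f), (f' \oc g').
split; first by rewrite compmA -(compmA f') g'g comp_idr.
by rewrite compmA -(compmA g) ff' comp_idr.
Qed.

Lemma is_zero_l X Y (f : mor X Y) : is_zero X -> f = 0.
Proof. by move=> X0; rewrite -[f]comp_idr X0 comp0r. Qed.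

Lemma is_zero_r X Y (f : mor X Y) : is_zero Y -> f = 0.
Proof. by move=> Y0; rewrite -[f]comp_idl Y0 comp0l. Qed.

Definition retract X Y : Prop :=
  exists (i : mor X Y) (p : mor Y X), p \oc i = idm X.

Lemma isomorphic_retract X Y : isomorphic X Y -> retract X Y.
Proof. by case=> f [g [gf _]]; exists f, g. Qed.

Lemma retract_trans X Y Z : retract X Y -> retract Y Z -> retract X Z.
Proof.
move=> [i [p pi]] [j [q qj]]; exists (j \oc i), (p \oc q).
by rewrite compmA -(compmA p) qj comp_idr.
Qed.

Lemma summand_retract X Y : summand X Y -> retract X Y.
Proof. by case=> X' [i [_ [p [_ [pi _ _ _ _]]]]]; exists i, p. Qed.

Lemma dsum_retract (I : finType) (Z : I -> C) Y i :
  is_dsum Z Y -> retract (Z i) Y.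
Proof. by case=> inj [proj [pi _ _]]; exists (inj i), (proj i). Qed.

Lemma dsum2_retract_l A B Y : is_dsum2 A B Y -> retract A Y.
Proof. by case=> i [_ [p [_ [pi _ _ _ _]]]]; exists i, p. Qed.

Lemma dsum2_retract_r A B Y : is_dsum2 A B Y -> retract B Y.
Proof. by case=> _ [i [_ [p [_ pi _ _ _]]]]; exists i, p. Qed.

(* The ideal generated by the identities of the objects in Q. *)
Inductive fac Q X Y : mor X Y -> Prop :=
| Fac0 : fac Q 0
| FacS A (a : mor X A) (b : mor A Y) f :
    Q A -> fac Q f -> fac Q (b \oc a + f).

(* X is a direct summand of a finite direct sum of objects in Q. *)
Definition adds Q X : Prop := fac Q (idm X).

Definition either A B X : Prop := A = X \/ B = X.

Lemma fac_comp Q X Y A (a : mor X A) (b : mor A Y) : Q A -> fac Q (b \oc a).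
Proof.
by move=> QA; rewrite -[_ \oc _]addr0; apply: FacS => //; apply: Fac0.
Qed.

Lemma facD Q X Y (f g : mor X Y) : fac Q f -> fac Q g -> fac Q (f + g).
Proof.
move=> Ff Fg; elim: Ff => [|A a b h QA _ IH]; first by rewrite add0r.
by rewrite -addrA; apply: FacS.
Qed.

Lemma fac_compl Q X Y Z (g : mor Y Z) (f : mor X Y) :
  fac Q f -> fac Q (g \oc f).
Proof.
elim=> [|A a b h QA _ IH]; first by rewrite comp0r; apply: Fac0.
by rewrite compDr compmA; apply: FacS.
Qed.

Lemma fac_compr Q X Y Z (g : mor Y Z) (f : mor X Y) :
  fac Q g -> fac Q (g \oc f).
Proof.
elim=> [|A a b h QA _ IH]; first by rewrite comp0l; apply: Fac0.
by rewrite compDl -compmA; apply: FacS.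
Qed.

Lemma facN Q X Y (f : mor X Y) : fac Q f -> fac Q (- f).
Proof. by rewrite -[f in - f]comp_idl -compNl; apply: fac_compl. Qed.

Lemma fac_sum Q (I : finType) X Y (F : I -> mor X Y) :
  (forall i, fac Q (F i)) -> fac Q (\sum_i F i).
Proof.
by move=> FF; elim/big_ind: _ => //; [apply: Fac0 | apply: facD].
Qed.

Lemma fac_trans Q Q' X Y (f : mor X Y) :
  (forall A, Q A -> adds Q' A) -> fac Q f -> fac Q' f.
Proof.
move=> QQ'; elim=> [|A a b h QA _ IH]; first exact: Fac0.
apply: facD => //; rewrite -[a]comp_idl; apply: fac_compl; apply: fac_compr.
exact: QQ'.
Qed.

Lemma adds_trans Q Q' X :
  (forall A, Q A -> adds Q' A) -> adds Q X -> adds Q' X.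
Proof. exact: fac_trans. Qed.

Lemma adds_fac_l Q X Y (f : mor X Y) : adds Q X -> fac Q f.
Proof. by move=> QX; rewrite -[f]comp_idr; apply: fac_compl. Qed.

Lemma adds_fac_r Q X Y (f : mor X Y) : adds Q Y -> fac Q f.
Proof. by move=> QX; rewrite -[f]comp_idl; apply: fac_compr. Qed.

Lemma retract_adds Q X A : retract X A -> adds Q A -> adds Q X.
Proof.
case=> i [p pi] QA; rewrite /adds -pi -[i]comp_idl.
by apply: fac_compl; apply: fac_compr.
Qed.

Lemma adds_self Q A : Q A -> adds Q A.
Proof. by move=> QA; rewrite /adds -[idm A]comp_idl; apply: fac_comp. Qed.

Lemma retract_adds1 X A : retract X A -> adds (eq A) X.
Proof. by move=> XA; apply: retract_adds XA _; apply: adds_self. Qed.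

Lemma dsum_adds Q (I : finType) (Z : I -> C) Y :
  is_dsum Z Y -> (forall i, adds Q (Z i)) -> adds Q Y.
Proof.
move=> [inj [proj [_ _ sumE]]] QZ; rewrite /adds -sumE; apply: fac_sum => i.
by apply: fac_compl; apply: adds_fac_r.
Qed.

Lemma dsum2_adds Q A B Y :
  is_dsum2 A B Y -> adds Q A -> adds Q B -> adds Q Y.
Proof.
move=> [i1 [i2 [p1 [p2 [_ _ _ _ sumE]]]]] QA QB; rewrite /adds -sumE.
by apply: facD; apply: fac_compl; apply: adds_fac_r.
Qed.

Lemma in_add_adds S X : in_add S X -> adds (eq S) X.
Proof.
move=> [n [Y [SY /summand_retract XY]]]; apply: retract_adds XY _.
by apply: dsum_adds SY _ => _; apply: adds_self.
Qed.

Lemma comp_fac0_l Q W X Y (f : mor X Y) (g : mor W X) :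
  (forall A, Q A -> hom_vanishes A Y) -> fac Q g -> f \oc g = 0.
Proof.
move=> QY; elim=> [|A a b h QA _ IH]; first by rewrite comp0r.
by rewrite compDr IH compmA (QY A QA (f \oc b)) comp0l addr0.
Qed.

Lemma comp_fac0_r Q W X Y (f : mor X Y) (g : mor W X) :
  (forall A, Q A -> hom_vanishes W A) -> fac Q f -> f \oc g = 0.
Proof.
move=> QY; elim=> [|A a b h QA _ IH]; first by rewrite comp0l.
by rewrite compDl IH -compmA (QY A QA (a \oc g)) comp0r addr0.
Qed.

Lemma hom_vanishes_adds_l Q X Y :
  (forall A, Q A -> hom_vanishes A Y) -> adds Q X -> hom_vanishes X Y.
Proof. by move=> QY QX f; rewrite -[f]comp_idr (comp_fac0_l f QY). Qed.

Lemma hom_vanishes_adds_r Q X Y :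
  (forall A, Q A -> hom_vanishes X A) -> adds Q Y -> hom_vanishes X Y.
Proof. by move=> QX QY f; rewrite -[f]comp_idl (comp_fac0_r f QX). Qed.

Lemma fac_single S X Y (f : mor X Y) : fac (eq S) f ->
  exists (n : nat) (a : 'I_n -> mor X S) (b : 'I_n -> mor S Y),
    f = \sum_i (b i \oc a i).
Proof.
elim=> [|A a b h SA _ [n [a' [b' ->]]]].
  by exists 0%N, (fun=> 0), (fun=> 0); rewrite big_ord0.
subst A; exists n.+1.
exists (fun i => oapp a' a (unlift ord0 i)).
exists (fun i => oapp b' b (unlift ord0 i)).
rewrite big_ord_recl unlift_none /=; congr (_ + _).
by apply: eq_bigr => i _; rewrite liftK.
Qed.

Lemma dsum_factor n (Z : 'I_n -> C) V X Y
    (a : forall i, mor X (Z i)) (b : forall i, mor (Z i) Y) :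
  is_dsum Z V -> exists (f : mor X V) (g : mor V Y),
    g \oc f = \sum_i (b i \oc a i).
Proof.
move=> [inj [proj [pi pj _]]].
exists (\sum_i (inj i \oc a i)), (\sum_i (b i \oc proj i)).
rewrite comp_suml; apply: eq_bigr => i _; rewrite comp_sumr (bigD1 i) //=.
rewrite big1 ?addr0 => [|j ji].
  by rewrite compmA -(compmA (b i)) pi comp_idr.
by rewrite compmA -(compmA (b i)) pj // comp0r comp0l.
Qed.


Lemma is_iso_comp X Y Z (g : mor Y Z) (f : mor X Y) :
  is_iso g -> is_iso f -> is_iso (g \oc f).
Proof.
move=> [g' [g'g gg']] [f' [f'f ff']]; exists (f' \oc g').
split; first by rewrite compmA -(compmA f') g'g comp_idr.
by rewrite compmA -(compmA g) ff' comp_idr.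
Qed.

Lemma local_iso W X : isomorphic W X -> local_end W -> local_end X.
Proof.
move=> [i [p [pi ip]]] [W0 Wl]; split=> [X0|f g Nf Ng Nfg].
  by apply: W0; rewrite /is_zero -pi (is_zero_r i X0) comp0r.
have Ii : is_iso i by exists p.
have Ip : is_iso p by exists i.
have conj (f' : mor X X) : is_iso (p \oc f' \oc i) -> is_iso f'.
  move=> If; have -> : f' = i \oc (p \oc f' \oc i) \oc p.
    by rewrite !compmA ip comp_idl -compmA ip comp_idr.
  by apply: is_iso_comp => //; apply: is_iso_comp.
have [] := Wl (p \oc f \oc i) (p \oc g \oc i).
- by move/conj.
- by move/conj.
- by rewrite -compDl -compDr; apply: is_iso_comp => //; apply: is_iso_comp.
Qed.

(** In a local ring, a sum can be invertible only if one of its terms is. Hence one composite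
    through a single object of [Q] is already an isomorphism, and this splits [W] off that
    object. *)
Lemma local_fac Q W (f : mor W W) :
  local_end W -> fac Q f -> is_iso f -> exists A, Q A /\ retract W A.
Proof.
move=> [W0 Wl]; move=> Ff; elim: Ff => {f} [|A a b f QA Ff IH].
  by case=> g []; rewrite comp0r => /esym.
case: (classic (is_iso (b \oc a))) => [[g [gba _]] _|Nba].
  by exists A; split => //; exists a, (g \oc b); rewrite -compmA.
case: (classic (is_iso f)) => [/IH //|Nf].
by move/(Wl _ _ Nba Nf).
Qed.

Lemma local_adds Q W : local_end W -> adds Q W -> exists A, Q A /\ retract W A.
Proof. by move=> Wl QW; apply: local_fac Wl QW (is_iso_id W). Qed.

Lemma local_indecomposable X : local_end X -> indecomposable X.
Proof.
move=> [X0 Xl]; split=> // A B [i1 [i2 [p1 [p2 [p11 p22 p12 p21 sumE]]]]].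
have zero A' B' (j1 : mor A' X) (j2 : mor B' X) q1 q2 :
    q2 \oc j2 = idm B' -> q1 \oc j2 = 0 -> is_iso (j1 \oc q1) -> is_zero B'.
  move=> q22 q12 [g [ge _]]; rewrite /is_zero -q22 -[j2]comp_idl -ge.
  by rewrite -!compmA q12 !comp0r.
case: (classic (is_iso (i1 \oc p1))) => [/zero h|N1].
  by right; apply: h p22 p12.
case: (classic (is_iso (i2 \oc p2))) => [/zero h|N2].
  by left; apply: h p11 p21.
by case: (Xl _ _ N1 N2); rewrite sumE; apply: is_iso_id.
Qed.

Lemma biproduct_iso A B Y (i1 : mor A Y) (i2 : mor B Y) p1 p2 :
  biproduct i1 i2 p1 p2 -> is_zero B -> is_iso i1.
Proof.
move=> [p11 _ _ _ sumE] B0; exists p1; split=> //.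
by rewrite -sumE (is_zero_l i2 B0) comp0l addr0.
Qed.
End LinearCategory.

(** * Triangulated categories: exactness, splittings, approximations *)

Section Triangulated.
Variables (K : fieldType) (D : triCategory K).
Implicit Types (A B T U V W X Y Z : D) (Q : D -> Prop).

Lemma ex_zero : exists O : D, is_zero O.
Proof.
have [O [inj [proj [_ _ sumE]]]] :=
  has_dsums (fun i : 'I_0 => False_rect D (notF (ltn_ord i))).
by exists O; rewrite /is_zero -sumE big_ord0.
Qed.

Lemma ex_dsum2 A B : exists Y, is_dsum2 A B Y.
Proof.
have [Y [inj [proj [pi pj sumE]]]] :=
  has_dsums (fun i : 'I_2 => if i == ord0 then A else B).
pose j : 'I_2 := lift ord0 ord0.
exists Y, (inj ord0), (inj j), (proj ord0), (proj j).
split; [exact: (pi ord0) | exact: (pi j) | exact: (pj j ord0)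
       | exact: (pj ord0 j) |].
by rewrite -sumE big_ord_recl big_ord1.
Qed.

Lemma ex_dsum (I : finType) (X : I -> D) : exists Y, is_dsum X Y.
Proof.
have [Y [inj [proj [pi pj sumE]]]] :=
  has_dsums (fun i : 'I_#|I| => X (enum_val i)).
exists Y.
have e (i : I) : enum_val (enum_rank i) = i by apply: enum_rankK.
(* [enum_val (enum_rank i)] equals [i] only propositionally, so the structure maps are transported
   along that equality. *)
exists (fun i => ecast j (mor (X j) Y) (e i) (inj (enum_rank i))).
exists (fun i => ecast j (mor Y (X j)) (e i) (proj (enum_rank i))).
split=> [i|i j ij|].
- by move: (enum_rank i) (e i) => k ek; case: i / ek; apply: pi.
- have := pj (enum_rank i) (enum_rank j).
  rewrite (inj_eq enum_rank_inj) => /(_ ij).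
  move: (enum_rank i) (e i) (enum_rank j) (e j) => k ek l el.
  by case: i / ek {ij}; case: j / el.
rewrite -sumE (reindex enum_rank) /=; last exact/onW_bij/enum_rank_bij.
by apply: eq_bigr => i _; move: (enum_rank i) (e i) => k ek; case: i / ek.
Qed.

Lemma shm0 X Y : shm (0 : mor X Y) = 0.
Proof.
have := shm_linear 1 (0 : mor X Y) 0; rewrite !scale1r addr0.
by move/eqP; rewrite -subr_eq0 opprD addNKr oppr_eq0 => /eqP.
Qed.

Lemma shmD X Y (f g : mor X Y) : shm (f + g) = shm f + shm g.
Proof. by have := shm_linear 1 f g; rewrite !scale1r. Qed.

Lemma shmN X Y (f : mor X Y) : shm (- f) = - shm f.
Proof. by have := shm_linear (-1) f 0; rewrite shm0 !addr0 !scaleN1r. Qed.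

Lemma shm_surj X Y (f : mor (sh X) (sh Y)) : exists g : mor X Y, shm g = f.
Proof. by have [g _ gK] := shm_bij X Y; exists (g f). Qed.

Lemma shm_inj X Y : injective (@shm K D X Y).
Proof. exact/bij_inj/shm_bij. Qed.

Lemma is_zero_sh X : is_zero X -> is_zero (sh X).
Proof. by move=> X0; rewrite /is_zero -shm_id X0 shm0. Qed.

Lemma dist_rot1 X Y Z (f : mor X Y) (g : mor Y Z) (h : mor Z (sh X)) :
  dist f g h -> dist g h (- shm f).
Proof. by case: (dist_rot f g h). Qed.

Lemma dist_comp X Y Z (f : mor X Y) (g : mor Y Z) (h : mor Z (sh X)) :
  dist f g h -> g \oc f = 0.
Proof.
move=> fgh; have [O O0] := ex_zero.
have [|c [<- _]] := dist_mor (a := idm X) (b := f) (dist_id X O0) fgh.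
  by [].
by rewrite comp0r.
Qed.

(** The square from W -> 0 to g extends to a morphism from the rotated identity triangle of [W] to
    the rotated given one. Its third component is the shift of the required lift. *)
Lemma dist_lift X Y Z (f : mor X Y) (g : mor Y Z) (h : mor Z (sh X))
    W (x : mor W Y) :
  dist f g h -> g \oc x = 0 -> exists y : mor W X, x = f \oc y.
Proof.
move=> fgh gx; have [O O0] := ex_zero.
have [|c [_ cE]] := dist_mor (a := x) (b := (0 : mor O Z))
  (dist_rot1 (dist_id W O0)) (dist_rot1 fgh).
  by rewrite comp0r.
have [y yE] := shm_surj c; exists y; apply: shm_inj.
rewrite shm_comp yE; move: cE.
by rewrite shm_id compNr comp_idr compNl => /oppr_inj.
Qed.

Lemma dist_ext X Y Z (f : mor X Y) (g : mor Y Z) (h : mor Z (sh X))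
    W (x : mor Y W) :
  dist f g h -> x \oc f = 0 -> exists y : mor Z W, x = y \oc g.
Proof.
move=> fgh xf; have [O O0] := ex_zero.
have T : dist (0 : mor O W) (idm W) (0 : mor W (sh O)).
  by apply/dist_rot; rewrite shm0 oppr0; apply/dist_id/is_zero_sh.
have [|c [cE _]] := dist_mor (a := (0 : mor X O)) (b := x) fgh T.
  by rewrite comp0r.
by exists c; rewrite cE comp_idl.
Qed.

(** The obstruction to extending [x] along [f] is its composite with Z[-1] -> X. It is stated after
    one shift, which avoids negative shifts. *)
Lemma dist_ext_shift X Y Z (f : mor X Y) (g : mor Y Z) (h : mor Z (sh X))
    W (x : mor X W) :
  dist f g h -> shm x \oc h = 0 -> exists y : mor Y W, x = y \oc f.
Proof.
move=> /dist_rot1/dist_rot1 ghf /(dist_ext ghf) [y xE].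
have [y' y'E] := shm_surj y; exists (- y'); apply: shm_inj.
by rewrite xE shm_comp shmN y'E compNl compNr.
Qed.

(** The connecting map of the cone of a split monomorphism vanishes, so the cone lifts back to [Y].
    Subtracting the component of the lift along [i] makes it a complement. *)
Lemma split_mono_biproduct X Y (i : mor X Y) (p : mor Y X) :
  p \oc i = idm X ->
  exists Z (i' : mor Z Y) (p' : mor Y Z) (h : mor Z (sh X)),
    biproduct i i' p p' /\ dist i p' h.
Proof.
move=> pi; have [Z [g [h igh]]] := dist_cone i.
have h0 : h = 0.
  rewrite -[h]comp_idl -shm_id -pi shm_comp -compmA.
  have := dist_comp (dist_rot1 (dist_rot1 igh)).
  by move/eqP; rewrite compNl oppr_eq0 => /eqP ->; rewrite comp0r.
have [|s sE] := dist_lift (x := idm Z) (dist_rot1 igh).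
  by rewrite h0 comp0l.
have gi := dist_comp igh.
pose w := s - i \oc p \oc s.
have gw : g \oc w = idm Z by rewrite compBr !compmA gi !comp0l subr0.
have pw : p \oc w = 0 by rewrite compBr !compmA pi comp_idl subrr.
exists Z, w, g, h; split=> //; split=> //.
have [|y yE] := dist_lift (x := idm Y - i \oc p - w \oc g) igh.
  by rewrite !compBr !compmA gi gw comp0l subr0 comp_idr comp_idl subrr.
have : p \oc (i \oc y) = 0.
  by rewrite -yE !compBr !compmA pi pw comp_idl comp_idr comp0l subrr subr0.
rewrite compmA pi comp_idl => y0; move: yE; rewrite y0 comp0r => /eqP.
by rewrite -addrA -opprD subr_eq0 => /eqP.
Qed.

Lemma retract_summand X Y : retract X Y -> summand X Y.
Proof.
move=> [i [p pi]]; have [Z [i' [p' [_ [bp _]]]]] := split_mono_biproduct pi.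
by exists Z, i, i', p, p'.
Qed.

Lemma indecomposable_retract X Y :
  indecomposable Y -> ~ is_zero X -> retract X Y -> isomorphic X Y.
Proof.
move=> [_ Yi] X0 /retract_summand [X' [i [i' [p [p' bp]]]]].
have [//|X'0] : is_zero X \/ is_zero X' by apply: Yi; exists i, i', p, p'.
by exists i; apply: biproduct_iso bp X'0.
Qed.

Lemma biproduct_dist A B Y (i1 : mor A Y) (i2 : mor B Y) p1 p2 :
  biproduct i1 i2 p1 p2 -> exists h : mor B (sh A), dist i1 p2 h.
Proof.
move=> [p11 p22 p12 p21 sumE].
have [Z [j [q [h [[_ qj pj qi sumE'] d]]]]] := split_mono_biproduct p11.
have pq : p2 \oc j \oc q = p2.
  move: (congr1 (fun e => p2 \oc e) sumE').
  by rewrite compDr !compmA p21 comp0l add0r comp_idr.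
have qp : q \oc i2 \oc p2 = q.
  move: (congr1 (fun e => q \oc e) sumE).
  by rewrite compDr !compmA qi comp0l add0r comp_idr.
have ji : p2 \oc j \oc (q \oc i2) = idm B by rewrite compmA pq.
have ij : q \oc i2 \oc (p2 \oc j) = idm Z by rewrite compmA qp.
exists (h \oc (q \oc i2)).
have Ic : is_iso (p2 \oc j) by exists (q \oc i2).
apply: (dist_iso (is_iso_id A) (is_iso_id Y) Ic _ _ _ d).
- by rewrite comp_idl comp_idr.
- by rewrite pq comp_idr.
- by rewrite shm_id comp_idl -compmA ij comp_idr.
Qed.

Lemma adds_in_add S X : adds (eq S) X -> in_add S X.
Proof.
move=> /fac_single [n [a [b idE]]].
have [Y SY] := has_dsums (fun _ : 'I_n => S).
exists n, Y; split=> //; apply: retract_summand.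
by have [f [g gf]] := dsum_factor a b SY; exists f, g; rewrite gf.
Qed.

Lemma hom_basis A B : exists e : 'I_(\dim {:mor A B}) -> mor A B,
  forall f, exists c : 'I_(\dim {:mor A B}) -> K, f = \sum_i c i *: e i.
Proof.
exists (fun i => (vbasis {:mor A B})`_i) => f.
exists (fun i => coord (vbasis {:mor A B}) i f).
exact: coord_vbasis (memvf f).
Qed.

(** Hom-finiteness enters here: one copy of [S] is taken for each vector of a basis of Hom(S, A). *)
Lemma ex_right_approx S A : exists X (f : mor X A),
  adds (eq S) X /\ forall g : mor S A, exists h, g = f \oc h.
Proof.
have [e eP] := hom_basis S A.
have [X SX] := has_dsums (fun _ : 'I_(\dim {:mor S A}) => S).
have SXa : adds (eq S) X by apply: dsum_adds SX _ => _; apply: adds_self.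
case: SX => inj [proj [pi pj _]].
exists X, (\sum_i (e i \oc proj i)); split=> // g; have [c ->] := eP g.
exists (\sum_i c i *: inj i); rewrite comp_sumr; apply: eq_bigr => i _.
rewrite comp_suml (bigD1 i) //= big1 ?addr0 => [|j ji].
  by rewrite compZr -compmA pi comp_idr.
by rewrite -compmA compZr pj 1?eq_sym // scaler0 comp0r.
Qed.

Lemma ex_left_approx U A : exists X (f : mor A X), left_approx U f.
Proof.
have [e eP] := hom_basis A U.
have [X SX] := has_dsums (fun _ : 'I_(\dim {:mor A U}) => U).
have SXa : adds (eq U) X by apply: dsum_adds SX _ => _; apply: adds_self.
case: SX => inj [proj [pi pj _]].
exists X, (\sum_i (inj i \oc e i)); split; first exact: adds_in_add.
move=> V /in_add_adds UV g.
suff : forall g' : mor A V, fac (eq U) g' ->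
    exists h : mor X V, h \oc (\sum_i (inj i \oc e i)) = g'.
  by apply; apply: adds_fac_r.
move=> g'; elim=> [|B a b f UB _ [h <-]]; first by exists 0; rewrite comp0l.
subst B; have [c ->] := eP a.
exists (b \oc (\sum_i c i *: proj i) + h); rewrite compDl -compmA.
congr (_ \oc _ + _).
rewrite comp_sumr; apply: eq_bigr => i _.
rewrite comp_suml (bigD1 i) //= big1 ?addr0 => [|j ji].
  by rewrite compZl compmA pi comp_idl.
by rewrite compmA compZl pj 1?eq_sym // scaler0 comp0l.
Qed.

(** A nonzero summand of the target missed by the approximation can be split off, and this lowers
    the dimension of the endomorphism algebra of the target. Induction on that dimension therefore
    reaches a minimal approximation. *)
Lemma ex_min_left_approx U A : exists X (f : mor A X), min_left_approx U f.
Proof.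
have [X0 [f0 Af0]] := ex_left_approx U A.
have [n] := ubnP (\dim {:mor X0 X0}).
elim: n => // n IH in X0 f0 Af0 *; rewrite ltnS => dim_n.
case: (classic (left_minimal f0)) => [|/not_all_ex_not [U1]].
  by exists X0, f0.
move=> /not_all_ex_not [U2] /not_all_ex_not [i1] /not_all_ex_not [i2].
move=> /not_all_ex_not [p1] /not_all_ex_not [p2] H.
have [bp {}H] := imply_to_and _ _ H; have [p2f U20] := imply_to_and _ _ H.
case: bp => [p11 p22 p12 p21 sumE].
apply: (IH U1 (p1 \oc f0)).
  split.
    apply: adds_in_add; apply: retract_adds (in_add_adds Af0.1).
    by exists i1, p1.
  move=> V UV g; have [h hE] := Af0.2 V UV g.
  exists (h \oc i1); rewrite -compmA (compmA i1) -hE -[f0 in RHS]comp_idl -sumE.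
  by rewrite compDl -!compmA p2f comp0r addr0.
apply: leq_trans dim_n.
have lin : linear (fun x : mor X0 X0 => p1 \oc x \oc i1).
  by move=> a x y; rewrite comp_linear_r comp_linear_l.
pose phi : {linear mor X0 X0 -> mor U1 U1} :=
  HB.pack (fun x : mor X0 X0 => p1 \oc x \oc i1)
    (GRing.isLinear.Build K _ _ *:%R _ lin).
have phi_surj : (linfun phi @: {:mor X0 X0} = {:mor U1 U1})%VS.
  apply/vspaceP => y; rewrite memvf; apply/memv_imgP.
  exists (i1 \oc y \oc p1); rewrite ?memvf // lfunE /=.
  by rewrite !compmA p11 comp_idl -compmA p11 comp_idr.
rewrite -(limg_ker_dim (linfun phi) {:mor X0 X0}) phi_surj.
rewrite -[X in (X < _)%N]add0n.
rewrite ltn_add2r lt0n dimv_eq0; apply/eqP => ker0; apply: U20.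
(* The compression of End(X0) onto End(U1) kills the idempotent of the discarded summand. This
   idempotent is nonzero, so the dimension drops strictly. *)
have : i2 \oc p2 \in ({:mor X0 X0} :&: lker (linfun phi))%VS.
  by rewrite memv_cap memvf memv_ker lfunE /= compmA p12 !comp0l.
rewrite ker0 memv0 => /eqP e0.
by rewrite /is_zero -p22 -[i2]comp_idr -p22 (compmA i2) e0 comp0l comp0r.
Qed.

End Triangulated.

(** * Vanishing of extensions and maximality of silting objects *)

Section Vanishing.
Variables (K : fieldType) (D : triCategory K).
Implicit Types (A B T U V W X Y Z : D) (Q : D -> Prop).

Definition tri X Y Z : Prop :=
  exists (f : mor X Y) (g : mor Y Z) (h : mor Z (sh X)), dist f g h.

Lemma tri_rot X Y Z : tri X Y Z -> tri Y Z (sh X).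
Proof. by move=> [f [g [h /dist_rot1 d]]]; exists g, h, (- shm f). Qed.

Lemma tri_shn i X Y Z : tri X Y Z -> tri (shn i X) (shn i Y) (shn i Z).
Proof. by elim: i => //= i IH /IH; do 3 move/tri_rot. Qed.

Lemma shnSr i X : shn i (sh X) = shn i.+1 X.
Proof. by rewrite /shn iterSr. Qed.

Lemma hom_vanishes_sh X Y : hom_vanishes (sh X) (sh Y) <-> hom_vanishes X Y.
Proof.
split=> XY f; first by apply: shm_inj; rewrite shm0; apply: XY.
by have [g <-] := shm_surj f; rewrite (XY g) shm0.
Qed.

Lemma hom_vanishes_shn i X Y :
  hom_vanishes (shn i X) (shn i Y) <-> hom_vanishes X Y.
Proof. by elim: i => //= i IH; rewrite hom_vanishes_sh. Qed.

Lemma hom_vanishes_shn_le i j X Y : (i <= j)%N ->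
  hom_vanishes (shn i X) (shn j Y) <-> hom_vanishes X (shn (j - i) Y).
Proof.
move=> ij; have -> : shn j Y = shn i (shn (j - i) Y).
  by rewrite /shn -iterD subnKC.
exact: hom_vanishes_shn.
Qed.

Lemma hom_vanishes_retract_l X X' Y :
  retract X X' -> hom_vanishes X' Y -> hom_vanishes X Y.
Proof.
move=> [i [p pi]] X'Y f.
by rewrite -[f]comp_idr -pi compmA (X'Y (f \oc p)) comp0l.
Qed.

Lemma hom_vanishes_retract_r X Y Y' :
  retract Y Y' -> hom_vanishes X Y' -> hom_vanishes X Y.
Proof.
move=> [i [p pi]] X'Y f.
by rewrite -[f]comp_idl -pi -compmA (X'Y (i \oc f)) comp0r.
Qed.

Lemma retract_sh X Y : retract X Y -> retract (sh X) (sh Y).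
Proof.
by move=> [i [p pi]]; exists (shm i), (shm p); rewrite -shm_comp pi shm_id.
Qed.

Lemma retract_shn i X Y : retract X Y -> retract (shn i X) (shn i Y).
Proof. by elim: i => //= i IH /IH/retract_sh. Qed.

Lemma fac_shm Q X Y (f : mor X Y) :
  fac Q f -> fac (fun B => exists2 A, Q A & sh A = B) (shm f).
Proof.
elim=> [|A a b {}f QA _ IH]; first by rewrite shm0; apply: Fac0.
by rewrite shmD shm_comp; apply: FacS => //; exists A.
Qed.

Lemma adds_sh Q X :
  adds Q X -> adds (fun B => exists2 A, Q A & sh A = B) (sh X).
Proof. by rewrite /adds -shm_id; apply: fac_shm. Qed.

Lemma adds_sh1 X Y : adds (eq Y) X -> adds (eq (sh Y)) (sh X).
Proof.
by move/adds_sh; apply: adds_trans => _ [_ <- <-]; apply: adds_self.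
Qed.

Lemma adds_shn i Q X :
  adds Q X -> adds (fun B => exists2 A, Q A & shn i A = B) (shn i X).
Proof.
move=> QX; elim: i => [|i IH] /=.
  by apply: adds_trans QX => A QA; apply: adds_self; exists A.
apply: adds_trans (adds_sh IH) => _ [_ [A QA <-] <-].
by apply: adds_self; exists A.
Qed.

(** The lowest degree is a parameter because shifting either argument moves it by one. For [m = 1]
    and equal arguments this is the condition in [presilting]. *)
Definition hvan (m : nat) X Y : Prop :=
  forall i : nat, (m <= i)%N -> hom_vanishes X (shn i Y).

Lemma hvan_adds_l m Q X Y :
  (forall A, Q A -> hvan m A Y) -> adds Q X -> hvan m X Y.
Proof.
move=> QY QX i mi; apply: hom_vanishes_adds_l QX => A QA; exact: QY.
Qed.

Lemma hvan_adds_r m Q X Y :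
  (forall A, Q A -> hvan m X A) -> adds Q Y -> hvan m X Y.
Proof.
move=> QX QY i mi; apply: hom_vanishes_adds_r (adds_shn i QY).
by move=> _ [A QA <-]; apply: QX.
Qed.

Lemma hvan_adds m Q Q' X Y :
  (forall A B, Q A -> Q' B -> hvan m A B) -> adds Q X -> adds Q' Y ->
  hvan m X Y.
Proof.
move=> QQ QX QY; apply: hvan_adds_l QX => A QA; apply: hvan_adds_r QY => B QB.
exact: QQ.
Qed.

Lemma hvanW m m' X Y : (m <= m')%N -> hvan m X Y -> hvan m' X Y.
Proof. by move=> mm XY i mi; apply: XY; apply: leq_trans mi. Qed.

Lemma hvan_shr m X Y : hvan m X (sh Y) <-> hvan m.+1 X Y.
Proof.
split=> XY i mi; last by rewrite shnSr; apply: XY.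
by case: i mi => // i mi; rewrite -shnSr; apply: XY.
Qed.

Lemma hvan_shl m X Y : hvan m.+1 (sh X) Y <-> hvan m X Y.
Proof.
split=> XY i mi; first by apply/hom_vanishes_sh; apply: (XY i.+1).
by case: i mi => // i mi; apply/(hom_vanishes_sh X (shn i Y)); apply: XY.
Qed.

Lemma hom_vanishes_mid_r X Y Z W : tri X Y Z ->
  hom_vanishes W X -> hom_vanishes W Z -> hom_vanishes W Y.
Proof.
move=> [f [g [h d]]] WX WZ x; have [y ->] := dist_lift d (WZ (g \oc x)).
by rewrite (WX y) comp0r.
Qed.

Lemma hom_vanishes_mid_l X Y Z W : tri X Y Z ->
  hom_vanishes X W -> hom_vanishes Z W -> hom_vanishes Y W.
Proof.
move=> [f [g [h d]]] XW ZW x; have [y ->] := dist_ext d (XW (x \oc f)).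
by rewrite (ZW y) comp0l.
Qed.

Lemma hvan_mid_r m X Y Z W : tri X Y Z ->
  hvan m W X -> hvan m W Z -> hvan m W Y.
Proof.
move=> t WX WZ i mi.
by apply: hom_vanishes_mid_r (tri_shn i t) (WX i mi) (WZ i mi).
Qed.

Lemma hvan_mid_l m X Y Z W : tri X Y Z ->
  hvan m X W -> hvan m Z W -> hvan m Y W.
Proof.
move=> t XW ZW i mi; exact: hom_vanishes_mid_l t (XW i mi) (ZW i mi).
Qed.

(** A rotated biproduct triangle shows that a thick subcategory is closed under finite direct sums.
    A sum of factorizations can thus be collected into one. *)
Lemma thick_fac (P : D -> Prop) Q X Y (f : mor X Y) : thick_subcat P ->
  (forall A, Q A -> P A) -> fac Q f ->
  exists2 B, P B & exists (a : mor X B) (b : mor B Y), f = b \oc a.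
Proof.
move=> tP QP; elim=> [|A a b {}f QA _ [B PB [a' [b' ->]]]].
  have [O O0] := ex_zero D; exists O; first exact: thick_zero tP _ O0.
  by exists 0, 0; rewrite comp0l.
have [Y' [i1 [i2 [p1 [p2 bp]]]]] := ex_dsum2 A B.
have [p11 p22 p12 p21 _] := bp.
have [h /dist_rot1/dist_rot1 d] := biproduct_dist bp; exists Y'.
  apply: (thick_sh tP Y').2; apply: (thick_cone tP d) => //.
  by apply: (thick_sh tP A).1; apply: QP.
exists (i1 \oc a + i2 \oc a'), (b \oc p1 + b' \oc p2).
rewrite !compDl !compDr !compmA -!(compmA b) -!(compmA b') p11 p22 p12 p21.
by rewrite !(comp0l, comp0r, comp_idl, comp_idr) addr0 add0r.
Qed.

Lemma thick_adds (P : D -> Prop) Q X : thick_subcat P ->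
  (forall A, Q A -> P A) -> adds Q X -> P X.
Proof.
move=> tP QP /(thick_fac tP QP) [B PB [a [b ba]]].
by apply: thick_summand tP _ _ _ PB; apply: retract_summand; exists a, b.
Qed.

Lemma thick_third (P : D -> Prop) X Y Z : thick_subcat P ->
  tri X Y Z -> P X -> P Y -> P Z.
Proof. by move=> tP [f [g [h d]]]; apply: thick_cone d. Qed.

(* Hom(M[i], Y) = 0 for all integers i <= l; the index j avoids negative      *)
(* shifts.                                                                    *)
Definition amp (l : nat) (M Y : D) : Prop :=
  forall i j : nat, (i <= j + l)%N -> hom_vanishes (shn i M) (shn j Y).

Lemma amp_leq l l' M Y : (l <= l')%N -> amp l' M Y -> amp l M Y.
Proof.
by move=> ll' MY i j ij; apply: MY; apply: leq_trans ij _; rewrite leq_add2l.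
Qed.

(** The objects for which some bound exists form a thick subcategory containing [M]: a shift changes
    the bound by at most one, and a cone takes the larger of two bounds. *)
Lemma thick_amp M X : thick M X ->
  exists l, forall Y, amp l M Y -> hom_vanishes X Y.
Proof.
pose P X := exists l, forall Y, amp l M Y -> hom_vanishes X Y.
have PshS X' : P X' -> P (sh X').
  move=> [l PX]; exists l.+1 => Y MY.
  (* The suspension is only essentially surjective, so [Y] is replaced by the isomorphic object
     [sh (unsh Y)] before one shift is cancelled. *)
  apply: hom_vanishes_retract_r (_ : retract Y (sh (unsh Y))) _.
    by apply/isomorphic_retract/isomorphic_sym/sh_unsh.
  apply/hom_vanishes_sh/PX => i j ij.
  apply/hom_vanishes_sh; rewrite -[sh (shn j _)]/(shn j.+1 (unsh Y)) -shnSr.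
  apply: hom_vanishes_retract_r (_ : retract _ (shn j Y)) _.
    by apply/retract_shn/isomorphic_retract/sh_unsh.
  by apply: (MY i.+1 j); rewrite addnS ltnS.
move=> MX; apply: (MX P); last first.
  by exists 0%N => Y /(_ 0%N 0%N); apply.
split.
- by move=> O O0; exists 0%N => Y _ f; apply: is_zero_l.
- move=> X'; split=> [|[l PX]]; first exact: PshS.
  exists l => Y MY; apply/hom_vanishes_sh/PX => i j ij.
  by rewrite shnSr; apply: MY; rewrite addSn; apply: leqW.
- move=> X' Y' Z' f g h d PX' [l2 PY']; have [l1 PsX'] := PshS _ PX'.
  exists (maxn l1 l2) => Y MY.
  have t : tri Y' Z' (sh X') by exists g, h, (- shm f); apply: dist_rot1.
  apply: hom_vanishes_mid_l t (PY' _ _) (PsX' _ _).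
    by apply: amp_leq MY; apply: leq_maxr.
  by apply: amp_leq MY; apply: leq_maxl.
- move=> X' Y' /summand_retract rX [l PY']; exists l => Y MY.
  exact: hom_vanishes_retract_l rX (PY' Y MY).
Qed.

(* Truncating Y from below by a right approximation M[l+1]^r -> Y raises l    *)
(* without affecting the vanishing of maps from X.                            *)
Lemma hom_vanishes_amp M X Y l : silting M -> hvan 1 X M -> amp l M Y ->
  hom_vanishes X Y.
Proof.
move=> [preM thM] XM; have [L PL] := thick_amp (thM X).
(* Induction on a bound [d] for the distance from [l] to the threshold [L] at which [thick_amp]
   applies. *)
have [d] : exists d, (L <= l + d)%N by exists L; apply: leq_addl.
elim: d => [|d IH] in l Y * => Lld MY.
  by apply: PL; apply: amp_leq MY; rewrite addn0 in Lld.
have [X' [a [MX' aP]]] := ex_right_approx (shn l.+1 M) Y.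
have [Y' [b [c d']]] := dist_cone a.
have t : tri X' Y Y' by exists a, b, c.
have XX' : hom_vanishes X X'.
  by apply: hom_vanishes_adds_r MX' => _ <-; apply: XM.
have lX' i j : (i <= j + l.+1)%N -> hom_vanishes (shn i M) (shn j.+1 X').
  move=> ij; apply: hom_vanishes_adds_r (adds_shn j.+1 MX') => _ [_ <- <-].
  rewrite /shn -iterD; apply/hom_vanishes_shn_le.
    by apply: leq_trans ij _; rewrite addSn.
  by apply: preM; rewrite subn_gt0 addSn ltnS.
suff MY' : amp l.+1 M Y'.
  move=> f; have bf : b \oc f = 0 by apply: (IH l.+1 Y') => //; rewrite addSnnS.
  by have [y ->] := dist_lift d' bf; rewrite (XX' y) comp0r.
move=> i j; rewrite leq_eqVlt => /orP [/eqP ->|ij]; last first.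
  rewrite addnS ltnS in ij.
  apply: hom_vanishes_mid_r (tri_rot (tri_shn j t)) (MY i j ij) (lX' i j _).
  by rewrite addnS; apply: leqW.
(* In the extreme degree, cancelling [j] leaves maps from M[l+1] to Y'. They lift to [Y], hence
   factor through the approximation [a], and so vanish in the cone. *)
rewrite /shn iterD; apply/hom_vanishes_shn => f.
have cf : c \oc f = 0 by apply: (lX' l.+1 0%N).
have [y ->] := dist_lift (dist_rot1 d') cf; have [z ->] := aP y.
by rewrite compmA (dist_comp d') comp0l.
Qed.

(** The cone [Y] of a right add M-approximation of [X] receives no map from [M] in any degree at
    least 0. By [hom_vanishes_amp] the map from [X] to [Y] is then zero, so the approximation
    splits. *)
Lemma silting_max M X : silting M -> hvan 1 M X -> hvan 1 X M -> adds (eq M) X.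
Proof.
move=> sM MX XM; have preM := sM.1.
have [X' [a [MX' aP]]] := ex_right_approx M X.
have [Y [b [c d]]] := dist_cone a.
have MX'1 : hvan 1 M X' by apply: hvan_adds_r MX' => _ <-.
have MY : hvan 0 M Y.
  case=> [_ f|i _].
    have cf : c \oc f = 0 by apply: (MX'1 1%N).
    have [y ->] := dist_lift (dist_rot1 d) cf; have [z ->] := aP y.
    by rewrite compmA (dist_comp d) comp0l.
  have t : tri X' X Y by exists a, b, c.
  apply: hom_vanishes_mid_r (tri_rot (tri_shn i.+1 t)) _ _; first exact: MX.
  exact: (MX'1 i.+2).
have bX : b = 0.
  apply: (hom_vanishes_amp (l := 0) sM XM) => i j; rewrite addn0 => ij.
  by apply/hom_vanishes_shn_le => //; apply: MY.
have [|y idE] := dist_lift (x := idm X) d; first by rewrite bX comp0l.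
by rewrite /adds idE; apply: fac_compr; apply: adds_fac_l.
Qed.

End Vanishing.

(** * Krull-Schmidt categories and basic objects *)

Section KrullSchmidt.
Variables (K : fieldType) (D : triCategory K).
Hypothesis KS : krull_schmidt D.
Implicit Types (A B E W X Y Z : D) (Q : D -> Prop).

Lemma indecomposable_local X : indecomposable X -> local_end X.
Proof.
move=> Xi; have [n [Z [ZX Zl]]] := KS X.
case: n Z ZX Zl => [|n] Z ZX Zl.
  have [inj [proj [_ _ sumE]]] := ZX.
  by case: Xi => -[]; rewrite /is_zero -sumE big_ord0.
have ZX0 := dsum_retract ord0 ZX.
exact: local_iso (indecomposable_retract Xi (Zl ord0).1 ZX0) (Zl ord0).
Qed.

Lemma adds_local Q X : (forall W, local_end W -> retract W X -> adds Q W) ->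
  adds Q X.
Proof.
move=> QX; have [n [Z [ZX Zl]]] := KS X; apply: (dsum_adds ZX) => i.
exact: QX (Zl i) (dsum_retract i ZX).
Qed.

Lemma basic_summand n (Z : 'I_n -> D) B W : basic_decomp Z B ->
  local_end W -> adds (eq B) W -> exists i, isomorphic W (Z i).
Proof.
move=> [Zi _ ZB] Wl BW.
have : adds (fun A => exists i, Z i = A) W.
  apply: adds_trans BW => _ <-; apply: dsum_adds ZB _ => i.
  by apply: adds_self; exists i.
move/(local_adds Wl) => [_ [[i <-] Wr]]; exists i.
exact: indecomposable_retract (Zi i) Wl.1 Wr.
Qed.

Lemma flat_adds E B : is_flat E B -> adds (eq E) B /\ adds (eq B) E.
Proof.
move=> [n [Z [[Zi Znoniso ZB] ZE EZ]]]; split.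
  by apply: dsum_adds ZB _ => i; apply/retract_adds1/summand_retract.
apply: adds_local => W Wl WE.
have [||i /isomorphic_retract Wr] := EZ W; first exact: local_indecomposable.
  exact: retract_summand.
by apply/retract_adds1/(retract_trans Wr)/dsum_retract.
Qed.

Lemma flat_basic E B : is_flat E B -> basic B.
Proof. by move=> [n [Z [Zb _ _]]]; exists n, Z. Qed.

(** Indecomposables have local endomorphism rings, so those in an additive closure are summands of
    its generator. Later arguments can therefore compare additive closures only. *)
Lemma flatP E B :
  is_flat E B <-> [/\ basic B, adds (eq E) B & adds (eq B) E].
Proof.
split=> [fB|[[n [Z Zb]] EB BE]].
  by have [EB BE] := flat_adds fB; split=> //; apply: flat_basic fB.
have [Zi _ ZB] := Zb; exists n, Z; split=> // [i|W Wi /summand_retract WE].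
  have [A [<- ZE]] : exists A, E = A /\ retract (Z i) A.
    apply: local_adds; first exact: indecomposable_local.
    by apply: retract_adds EB; apply: dsum_retract ZB.
  exact: retract_summand.
apply: (basic_summand Zb); first exact: indecomposable_local.
exact: retract_adds WE BE.
Qed.

Lemma iso_representatives n (Z : 'I_n -> D) :
  exists m (W : 'I_m -> D),
  [/\ forall j, exists i, W j = Z i,
      forall i j, i != j -> ~ isomorphic (W i) (W j)
    & forall i, exists j, isomorphic (Z i) (W j)].
Proof.
elim: n => [|n IH] in Z *.
  by exists 0%N, Z; split=> -[].
have [m [W [WZ Wn ZW]]] := IH (fun i => Z (lift ord0 i)).
have {}WZ j : exists i, W j = Z i.
  by have [i ->] := WZ j; exists (lift ord0 i).
case: (classic (exists j, isomorphic (Z ord0) (W j))) => [Z0|Z0].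
  exists m, W; split=> // i; case: (unliftP ord0 i) => [k ->|-> //].
  exact: ZW.
exists m.+1, (fun i => oapp W (Z ord0) (unlift ord0 i)); split=> [j|i j|i].
- by case: (unliftP ord0 j) => [k _|_] /=; [apply: WZ | exists ord0].
- case: (unliftP ord0 i) => [k ->|->]; case: (unliftP ord0 j) => [l ->|->] //=.
  + by rewrite (inj_eq lift_inj); apply: Wn.
  + by move=> _ /isomorphic_sym WZ0; apply: Z0; exists k.
  + by move=> _ WZ0; apply: Z0; exists l.
case: (unliftP ord0 i) => [k ->|->]; last first.
  by exists ord0; rewrite unlift_none; apply: isomorphic_refl.
by have [l kl] := ZW k; exists (lift ord0 l); rewrite liftK.
Qed.

Lemma ex_flat E : exists B, is_flat E B.
Proof.
have [n [Z [ZE Zl]]] := KS E; have [m [W [WZ Wn ZW]]] := iso_representatives Z.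
have [B WB] := has_dsums W; exists B; apply/flatP; split.
- exists m, W; split=> // i; apply: local_indecomposable.
  by have [j ->] := WZ i.
- apply: dsum_adds WB _ => i; have [j ->] := WZ i.
  exact/retract_adds1/dsum_retract.
apply: dsum_adds ZE _ => i; have [j /isomorphic_retract Wr] := ZW i.
exact/retract_adds1/(retract_trans Wr)/dsum_retract.
Qed.

(** Equal additive closures match the indecomposable summands in both directions. The two matchings
    are mutually inverse because distinct summands of a basic object are not isomorphic. *)
Lemma basic_iso A B : basic A -> basic B ->
  adds (eq A) B -> adds (eq B) A -> isomorphic A B.
Proof.
move=> [n [Z Zb]] [m [W Wb]] AB BA.
have [Zi Zn ZA] := Zb; have [Wi Wn WB] := Wb.
have ZW i : exists j, isomorphic (Z i) (W j).
  apply: (basic_summand Wb); first exact: indecomposable_local.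
  by apply: retract_adds BA; apply: dsum_retract ZA.
have WZ i : exists j, isomorphic (W i) (Z j).
  apply: (basic_summand Zb); first exact: indecomposable_local.
  by apply: retract_adds AB; apply: dsum_retract WB.
have [s sP] := fin_all_exists ZW; have [t tP] := fin_all_exists WZ.
have sK : cancel s t.
  move=> i; apply/eqP/negP => /negP /Zn; apply; apply/isomorphic_sym.
  exact: isomorphic_trans (sP i) (tP (s i)).
have tK : cancel t s.
  move=> i; apply/eqP/negP => /negP /Wn; apply; apply/isomorphic_sym.
  exact: isomorphic_trans (tP i) (sP (t i)).
have [a aP] := fin_all_exists sP; have [b bP] := fin_all_exists aP.
have [injA [projA [piA pjA sumA]]] := ZA.
have [injB [projB [piB pjB sumB]]] := WB.
exists (\sum_i (injB (s i) \oc a i \oc projA i)).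
exists (\sum_i (injA i \oc b i \oc projB (s i))); split.
  rewrite comp_suml -sumA; apply: eq_bigr => i _.
  rewrite comp_sumr (bigD1 i) //= big1 ?addr0 => [|j ji].
    rewrite !compmA -(compmA _ (projB _)) piB comp_idr.
    by rewrite -(compmA (injA i)) (bP i).1 comp_idr.
  rewrite !compmA -(compmA _ (projB _)) pjB ?comp0r ?comp0l //.
  by rewrite (can_eq sK).
rewrite comp_suml -sumB (reindex s) /=; last first.
  by exists t => i _; rewrite ?sK ?tK.
apply: eq_bigr => i _.
rewrite comp_sumr (bigD1 i) //= big1 ?addr0 => [|j ji].
  rewrite !compmA -(compmA _ (projA _)) piA comp_idr.
  by rewrite -(compmA (injB _)) (bP i).2 comp_idr.
by rewrite !compmA -(compmA _ (projA _)) pjA ?comp0r ?comp0l // eq_sym.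
Qed.

End KrullSchmidt.

(** * The subcategory S * S[1] *)

Section TwoTerm.
Variables (K : fieldType) (D : triCategory K) (S : D).
Hypothesis S_pre : hvan 1 S S.
Implicit Types (A B X Y Z : D) (Q : D -> Prop).

(* An intrinsic form of membership in S * S[1], visibly closed under direct   *)
(* summands.                                                                  *)
Definition two_term' Z : Prop :=
  forall Y, hom_vanishes S Y -> forall f : mor Z Y, fac (eq (sh S)) f.

Lemma two_term_tri Z : two_term S Z ->
  exists X Y, [/\ adds (eq S) X, adds (eq (sh S)) Y & tri X Z Y].
Proof.
move=> [X [Y [f [g [h [/in_add_adds SX /in_add_adds SY d]]]]]].
by exists X, Y; split=> //; exists f, g, h.
Qed.

(** Maps out of [Z] that vanish on its add S part factor through its add S[1] part. Conversely, the
    cone of a right add S-approximation of [Z] is shown to lie in add S[1]. *)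
Lemma two_termP Z : two_term S Z <-> two_term' Z.
Proof.
split=> [/two_term_tri [X [Y [SX SY [f [g [h d]]]]]] V SV x|Z2].
  have XV : hom_vanishes X V by apply: hom_vanishes_adds_l SX => _ <-.
  have [y ->] := dist_ext d (XV (x \oc f)).
  by apply: fac_compr; apply: adds_fac_l.
have [X [a [SX aP]]] := ex_right_approx S Z; have [Y [z [c d]]] := dist_cone a.
have SY : hom_vanishes S Y.
  have SX1 : hvan 1 S X by apply: hvan_adds_r SX => _ <-.
  move=> f; have [y ->] := dist_lift (dist_rot1 d) (SX1 1%N isT (c \oc f)).
  by have [x ->] := aP y; rewrite compmA (dist_comp d) comp0l.
have XsS : hom_vanishes X (sh S).
  by apply: hom_vanishes_adds_l SX => _ <-; apply: (S_pre (i := 1)).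
have SX1 : adds (eq (sh S)) (sh X) by apply: adds_sh1.
have ext V (x : mor Z V) : fac (eq (sh S)) x ->
    exists2 y : mor Y V, fac (eq (sh S)) y & x = y \oc z.
  elim=> [|B u v {}x SB _ [y Fy ->]].
    by exists 0; rewrite ?comp0l //; apply: Fac0.
  subst B; have [u' ->] := dist_ext d (XsS (u \oc a)).
  by exists (v \oc u' + y); [apply: FacS | rewrite compDl compmA].
(* The map from [Z] to its cone [Y] factors through add S[1], and the factorization extends to an
   endomorphism [w] of [Y]. The difference of the identity and [w] kills [z], so it factors through
   X[1]. *)
have [w Fw wE] := ext _ _ (Z2 Y SY z).
exists X, Y, a, z, c; split=> //; apply: adds_in_add => //.
have [|y yE] := dist_ext (x := idm Y - w) (dist_rot1 d).
  by rewrite compBl comp_idl -wE subrr.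
rewrite /adds -[idm Y](subrK w) yE; apply: facD => //.
by apply: fac_compr; apply: adds_fac_l.
Qed.

Lemma two_term_adds Q Z : (forall A, Q A -> two_term S A) -> adds Q Z ->
  two_term S Z.
Proof.
move=> Q2 QZ; apply/two_termP => Y SY f; rewrite -[f]comp_idr.
elim: QZ => [|A a b g QA _ IH]; first by rewrite comp0r; apply: Fac0.
rewrite compDr compmA; apply: facD => //; apply: fac_compr.
by have /two_termP := Q2 A QA; apply.
Qed.

Lemma hvan2_two_term_S Z : two_term S Z -> hvan 2 Z S.
Proof.
move=> /two_term_tri [X [Y [SX SY t]]]; apply: hvan_mid_l t _ _.
  by apply: hvan_adds_l SX => _ <-; apply: hvanW S_pre.
by apply: hvan_adds_l SY => _ <-; apply/hvan_shl.
Qed.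

(** A factorization of the restriction to [X] extends to [Y], since the obstruction lies in Hom(Z,
    S[2]) = 0. What remains of the map comes from [Z]. *)
Lemma two_term_ext X Y Z : tri X Y Z -> two_term S X -> two_term S Z ->
  two_term S Y.
Proof.
move=> [a [b [c d]]] /two_termP X2 Z2.
have Z22 : hom_vanishes Z (sh (sh S)) by apply: (hvan2_two_term_S Z2 (i := 2)).
apply/two_termP => V SV f.
have ext W (x : mor X W) : fac (eq (sh S)) x ->
    exists2 y : mor Y W, fac (eq (sh S)) y & x = y \oc a.
  elim=> [|B u v {}x SB _ [y Fy ->]].
    by exists 0; rewrite ?comp0l //; apply: Fac0.
  subst B; have [u' ->] := dist_ext_shift d (Z22 (shm u \oc c)).
  by exists (v \oc u' + y); [apply: FacS | rewrite compDl compmA].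
have [y Fy yE] := ext _ _ (X2 V SV (f \oc a)).
have [|z zE] := dist_ext (x := f - y) d; first by rewrite compBl yE subrr.
rewrite -[f](subrK y) zE; apply: facD => //; apply: fac_compr.
by move/two_termP: Z2; apply.
Qed.

Lemma hvan2_two_term Y Z : two_term S Y -> two_term S Z -> hvan 2 Y Z.
Proof.
move=> Y2 /two_term_tri [X [X' [SX SX' t]]]; apply: hvan_mid_r t _ _.
  by apply: hvan_adds_r SX => _ <-; apply: hvan2_two_term_S.
apply: hvan_adds_r SX' => _ <-; apply/hvan_shr.
by apply: hvanW (hvan2_two_term_S Y2).
Qed.

End TwoTerm.

(** * Universal extensions by add U *)

Section UniversalExtension.
Variables (K : fieldType) (D : triCategory K).
Implicit Types (A B T U V W X Y Z : D) (Q : D -> Prop).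

Definition ext_tri U T X (h : mor X T) : Prop :=
  exists U' (g : mor U' X) (w : mor T (sh U')), adds (eq U) U' /\ dist g h w.

(* If Hom(U, U[1]) = 0, the vanishing of Hom(X, U[1]) says that the third map *)
(* T -> U'[1] is a left add U[1]-approximation. Both B_U^-(T) and, with       *)
(* T = M_k[1] and U = L, left mutation are obtained in this way.              *)
Definition univ_ext U T X : Prop :=
  hom_vanishes X (sh U) /\ exists h : mor X T, ext_tri U h.

Lemma ext_tri_lift U T X (h : mor X T) W (x : mor W T) : ext_tri U h ->
  hom_vanishes W (sh U) -> exists y, x = h \oc y.
Proof.
move=> [U' [g [w [UU' d]]]] WU.
have WU' : hom_vanishes W (sh U').
  by apply: hom_vanishes_adds_r (adds_sh1 UU') => _ <-.
exact: dist_lift (dist_rot1 d) (WU' (w \oc x)).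
Qed.

Lemma ext_tri_ker U T X (h : mor X T) W (y : mor W X) : ext_tri U h ->
  h \oc y = 0 -> fac (eq U) y.
Proof.
move=> [U' [g [w [UU' d]]]] /(dist_lift d) [z ->].
by apply: fac_compr; apply: adds_fac_l.
Qed.

Lemma univ_ext_id U T : hom_vanishes T (sh U) -> univ_ext U T T.
Proof.
move=> TU; split=> //; have [O O0] := ex_zero D; exists (idm T), O, 0, 0.
split; first by rewrite /adds O0; apply: Fac0.
apply/dist_rot; rewrite shm0 oppr0; apply: dist_id; exact: is_zero_sh.
Qed.

(* Maps into X are detected modulo add U on T, where a factorization through  *)
(* A can be lifted to one through a universal extension of A.                 *)
Lemma ext_tri_fac Q Q' U T X (h : mor X T) W (f : mor W X) : ext_tri U h ->
  hom_vanishes W (sh U) -> Q' U ->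
  (forall A, Q A -> exists2 X', Q' X' & univ_ext U A X') ->
  fac Q (h \oc f) -> fac Q' f.
Proof.
move=> eh WU Q'U QQ' Fhf.
have lift (x : mor W T) : fac Q x -> exists2 y, fac Q' y & x = h \oc y.
  elim=> [|A a b {}x QA _ [y Fy ->]].
    by exists 0; rewrite ?comp0r //; apply: Fac0.
  have [X' Q'X' [X'U [hA eA]]] := QQ' A QA.
  have [a' ->] := ext_tri_lift a eA WU.
  have [b' b'E] := ext_tri_lift (b \oc hA) eh X'U.
  exists (b' \oc a' + y); first exact: FacS.
  by rewrite compDr compmA b'E -compmA.
have [y Fy yE] := lift _ Fhf.
rewrite -[f](subrK y); apply: facD => //.
apply: fac_trans (ext_tri_ker eh _) => [_ <-|]; first exact: adds_self.
by rewrite compBr yE subrr.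
Qed.

Lemma univ_ext_adds Q Q' U T X : univ_ext U T X -> Q' U -> adds Q T ->
  (forall A, Q A -> exists2 X', Q' X' & univ_ext U A X') -> adds Q' X.
Proof.
move=> [XU [h eh]] Q'U QT QQ'; apply: ext_tri_fac eh XU Q'U QQ' _.
exact: adds_fac_r.
Qed.

Lemma univ_ext_iso U T T' X : isomorphic T T' -> univ_ext U T X ->
  univ_ext U T' X.
Proof.
move=> [c [c' [c'c cc']]] [XU [h [U' [g [w [UU' d]]]]]]; split=> //.
have Ic : is_iso c by exists c'.
exists (c \oc h), U', g, (w \oc c'); split=> //.
apply: (dist_iso (is_iso_id U') (is_iso_id X) Ic _ _ _ d).
- by rewrite comp_idl comp_idr.
- by rewrite comp_idr.
- by rewrite shm_id comp_idl -compmA c'c comp_idr.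
Qed.

(** A map from [X] to U[1] vanishes on U', hence comes from a map A[1] -> U[1]. The approximation
    property factors the latter through the shift of [f], whose composite with [h] is zero. *)
Lemma left_approx_univ_ext U A U' X (f : mor A U') (g : mor U' X)
    (h : mor X (sh A)) : hom_vanishes U (sh U) ->
  left_approx U f -> dist f g h -> univ_ext U (sh A) X.
Proof.
move=> UU [/in_add_adds UU' fP] d; have d' := dist_rot1 d; split; last first.
  by exists h, U', g, (- shm f).
have U'U : hom_vanishes U' (sh U) by apply: hom_vanishes_adds_l UU' => _ <-.
move=> x; have [y ->] := dist_ext d' (U'U (x \oc g)).
have [y' <-] := shm_surj y.
have [|z <-] := fP U _ y'; first by apply/adds_in_add/adds_self.
have := dist_comp (dist_rot1 d'); rewrite compNl => /eqP.
by rewrite oppr_eq0 shm_comp -compmA => /eqP ->; rewrite comp0r.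
Qed.

Lemma ex_univ_ext U T : hom_vanishes U (sh U) -> exists X, univ_ext U T X.
Proof.
move=> UU; have [U' [f fP]] := ex_left_approx U (unsh T).
have [X [g [h d]]] := dist_cone f; exists X.
exact: univ_ext_iso (sh_unsh T) (left_approx_univ_ext UU fP d).
Qed.

Lemma univ_ext_tri U T X : univ_ext U T X ->
  exists2 U', adds (eq U) U' & tri U' X T.
Proof.
by move=> [_ [h [U' [g [w [UU' d]]]]]]; exists U' => //; exists g, h, w.
Qed.

(** Every vanishing but one is inherited from the two ends of the triangle. The exception, Hom(X,
    U[1]) = 0, is the defining property of a universal extension. *)
Lemma univ_ext_hvan U T X : univ_ext U T X ->
  hvan 1 U U -> hvan 1 T T -> hvan 1 U T -> hvan 2 T U ->
  [/\ hvan 1 X U, hvan 1 U X, hvan 1 X T & hvan 1 X X].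
Proof.
move=> eX UU TT UT TU; have [U' UU' t] := univ_ext_tri eX.
have U'T : hvan 1 U' T by apply: hvan_adds_l UU' => _ <-.
have XT : hvan 1 X T by apply: hvan_mid_l t _ _.
have XU : hvan 1 X U.
  case=> // -[_|i _]; first exact: eX.1.
  apply: (hvan_mid_l (m := 2) t _ TU) => //.
  by apply: hvan_adds_l UU' => _ <-; apply: hvanW UU.
split=> //; apply: hvan_mid_r t _ _ => //; by apply: hvan_adds_r UU' => _ <-.
Qed.

Lemma univ_ext_thick (P : D -> Prop) U T X : thick_subcat P ->
  univ_ext U T X -> P U -> P X -> P T.
Proof.
move=> tP /univ_ext_tri [U' UU' t] PU PX.
have PU' : P U' by apply: (thick_adds tP) UU' => _ <-.
exact: thick_third tP t PU' PX.
Qed.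

End UniversalExtension.

(** * Silting completions and the summand exchanged by mutation *)

Section Reduction.
Variables (K : fieldType) (D : triCategory K).
Hypothesis KS : krull_schmidt D.
Implicit Types (A B E L M N T U V W X Y Z : D) (Q : D -> Prop).

Lemma flat_dsum2P A B E Y : is_dsum2 A B E ->
  is_flat E Y <->
  [/\ basic Y, adds (either A B) Y, adds (eq Y) A & adds (eq Y) B].
Proof.
move=> ABE.
have EAB : adds (either A B) E.
  by apply: (dsum2_adds ABE); apply: adds_self; [left | right].
have EA := retract_adds1 (dsum2_retract_l ABE).
have EB := retract_adds1 (dsum2_retract_r ABE).
rewrite (flatP KS); split=> [[bY EY YE]|[bY ABY YA YB]]; split=> //.
- by apply: adds_trans EY => _ <-.
- by apply: adds_trans EA => _ <-.
- by apply: adds_trans EB => _ <-.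
- by apply: adds_trans ABY => _ [] <-.
- by apply: adds_trans EAB => _ [] <-.
Qed.

Lemma Bminus_univ_ext U T B : presilting U -> is_Bminus U T B ->
  exists2 X, univ_ext U T X &
    [/\ basic B, adds (either U X) B, adds (eq B) U & adds (eq B) X].
Proof.
move=> Upre [U' [X [E [f [g [h [[fa _] d UXE fB]]]]]]]; exists X.
  apply: univ_ext_iso (sh_unsh T) (left_approx_univ_ext _ fa d).
  exact: (Upre 1%N).
exact/(flat_dsum2P _ UXE).
Qed.

Lemma ex_Bminus U T : exists B, is_Bminus U T B.
Proof.
have [U' [f fP]] := ex_min_left_approx U (unsh T).
have [X [g [h d]]] := dist_cone f; have [E UXE] := ex_dsum2 U X.
by have [B EB] := ex_flat KS E; exists B, U', X, E, f, g, h.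
Qed.

Lemma univ_ext_silting U T X B : univ_ext U T X ->
  hvan 1 U U -> hvan 1 T T -> hvan 1 U T -> hvan 2 T U ->
  adds (either U X) B -> adds (eq B) U -> adds (eq B) X ->
  (forall P : D -> Prop, thick_subcat P -> P U -> P T -> forall Y, P Y) ->
  silting B.
Proof.
move=> eX UU TT UT TU BUX BU BX gen.
have [XU UX XT XX] := univ_ext_hvan eX UU TT UT TU; split=> [|Y P tP PB].
  by apply: (hvan_adds _ BUX BUX) => _ _ [] <- [] <-.
have PA A : adds (eq B) A -> P A by apply: (thick_adds tP) => _ <-.
by apply: (gen P tP); last apply: univ_ext_thick tP eX _ _; apply: PA.
Qed.

Lemma Bminus_silting S U T B : hvan 1 S S ->
  presilting U -> two_term S U -> silting T -> two_term S T ->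
  hvan 1 U T -> is_Bminus U T B -> basic_silting_in S B.
Proof.
move=> SS Upre U2 [Tpre Tth] T2 UT UB.
have [X eX [bB BUX BU BX]] := Bminus_univ_ext Upre UB.
have [U' UU' t] := univ_ext_tri eX; split=> //.
  apply: (univ_ext_silting eX Upre Tpre UT (hvan2_two_term SS T2 U2)) => //.
  by move=> P tP _ PT Y; apply: Tth.
apply: (two_term_adds SS) BUX => _ [] <- //.
apply: (two_term_ext SS) t _ T2.
by apply: (two_term_adds SS) UU' => _ <-.
Qed.

(* The data of a decomposition M = L + M_k, with X = M_k, at which M is to be *)
(* mutated.                                                                   *)
Record complement M L X : Prop := Complement {
  compl_local : local_end X;
  compl_l : adds (eq M) L;
  compl_r : adds (eq M) X;
  compl_gen : adds (either L X) M;
  compl_or : forall W, local_end W -> adds (eq M) W ->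
    isomorphic W X \/ adds (eq L) W
}.

Lemma basic_complement n (Mi : 'I_n -> D) M L k : basic_decomp Mi M ->
  is_dsum (fun i : {i : 'I_n | i != k} => Mi (val i)) L ->
  complement M L (Mi k).
Proof.
move=> Mb Ls; have [Mii _ Ms] := Mb.
have LM i : i != k -> adds (eq L) (Mi i).
  by move=> ik; apply: retract_adds1; apply: (dsum_retract (exist _ i ik) Ls).
split.
- exact: indecomposable_local.
- by apply: (dsum_adds Ls) => i; apply/retract_adds1/dsum_retract/Ms.
- exact/retract_adds1/dsum_retract/Ms.
- apply: (dsum_adds Ms) => i; have [->|/LM Li] := eqVneq i k.
    by apply: adds_self; right.
  by apply: adds_trans Li => _ <-; apply: adds_self; left.
move=> W Wl MW; have [i Wi] := basic_summand Mb Wl MW.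
have [<-|/LM Li] := eqVneq i k; [by left | right].
exact: retract_adds (isomorphic_retract Wi) Li.
Qed.

Lemma complement_dichotomy M L X Y : complement M L X ->
  adds (eq M) Y -> retract X Y \/ adds (eq L) Y.
Proof.
move=> c MY; case: (classic (retract X Y)) => [|XY]; [by left | right].
apply: (adds_local KS) => W Wl WY.
have [WX|//] := compl_or c Wl (retract_adds WY MY).
by case: XY; apply: retract_trans WY; apply/isomorphic_retract/isomorphic_sym.
Qed.

(* M1 has no summand X: such a summand, being also one of M0, could be        *)
(* connected to it through phi by Hom(U, U[1]) = 0, against minimality.       *)
Lemma resolution_dichotomy M L X U : silting M -> complement M L X ->
  hvan 1 U U -> hvan 1 U M -> hvan 2 M U ->
  (forall x : mor U X, fac (eq L) x) \/
  exists (M0 M1 : D) (phi : mor M0 M1),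
    [/\ ext_tri U phi, adds (eq L) M1 & retract X M0].
Proof.
move=> sM c UU UM MU; have [Mpre _] := sM.
have [M0 [u [ua umin]]] := ex_min_left_approx M U.
have [M1 [phi [w d]]] := dist_cone u.
have [MM0 uP] := ua; have aMM0 := in_add_adds MM0.
have MM1 : adds (eq M) M1.
  (* The cone of the approximation is a universal extension of U[1] by [M], so it has no positive
     extensions to or from [M], and maximality applies. *)
  have eM1 := left_approx_univ_ext (Mpre 1%N isT) ua d.
  have TT : hvan 1 (sh U) (sh U) by apply/hvan_shr/hvan_shl.
  have MT : hvan 1 M (sh U) by apply/hvan_shr.
  have TM : hvan 2 (sh U) M by apply/hvan_shl.
  have [M1M MM1 _ _] := univ_ext_hvan eM1 Mpre TT MT TM.
  exact: silting_max.
have ephi : ext_tri U phi by exists U, u, w; split=> //; apply: adds_self.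
case: (complement_dichotomy c aMM0) => [XM0|LM0]; last first.
  left=> x; have [y <-] := uP X (adds_in_add (compl_r c)) x.
  by apply: fac_compr; apply: adds_fac_l.
right; exists M0, M1, phi; split=> //.
case: (complement_dichotomy c MM1) => [[s [r rs]]|//].
have [m [p pm]] := XM0; have [X0 Xl] := compl_local c.
(* Otherwise X would split off M0 with projection [q \oc phi], which kills [u]; minimality would
   make X zero. *)
have nosplit (i : mor X M0) (q : mor M1 X) : q \oc phi \oc i <> idm X.
  move=> qi; have [Z [i' [p' [_ [[p11 p22 p12 p21 sumE] _]]]]] :=
    split_mono_biproduct qi.
  apply: X0; apply: (umin Z X i' i p' (q \oc phi)).
    by split=> //; rewrite addrC.
  by rewrite -compmA (dist_comp d) comp0r.
(* This element of Hom(U, U[1]) obstructs lifting [s \oc p \oc u] along [phi]. Its vanishing gives s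
   p = phi a + b phi, which writes the identity of X as a sum of two endomorphisms factoring through
   [phi]. *)
have wspu : w \oc (s \oc p \oc u) = 0 by apply: (UU 1%N).
have [a' a'E] := dist_lift (dist_rot1 d) wspu.
have [a aE] := uP M0 MM0 a'.
have [|b bE] := dist_ext (x := s \oc p - phi \oc a) d.
  by rewrite compBl a'E -compmA aE subrr.
have idE : r \oc phi \oc (a \oc m) + r \oc b \oc phi \oc m = idm X.
  rewrite -(compmA r b) -bE compBr compBl !compmA rs comp_idl pm.
  by rewrite addrC subrK.
case: (classic (is_iso (r \oc phi \oc (a \oc m)))) => [[z [zE _]]|N1].
  by case: (nosplit (a \oc m) (z \oc r)); rewrite -!compmA !compmA in zE *.
case: (classic (is_iso (r \oc b \oc phi \oc m))) => [[z [zE _]]|N2].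
  by case: (nosplit m (z \oc (r \oc b))); rewrite !compmA in zE *.
by case: (Xl _ _ N1 N2); rewrite idE; apply: is_iso_id.
Qed.

(** Modulo maps through add L, an idempotent of [X] induces an endomorphism psi of [T]. As End(T) is
    local, psi or 1 - psi is invertible, and the corresponding idempotent is then the identity
    modulo the ideal. *)
Lemma idempotent_dichotomy U L T X XL (e : mor X X) :
  local_end T -> hom_vanishes T (sh L) -> (forall x : mor U T, fac (eq L) x) ->
  univ_ext U T X -> univ_ext U L XL -> e \oc e = e ->
  fac (either U XL) e \/ fac (either U XL) (idm X - e).
Proof.
move=> [T0 Tl] TL UTL [XU [h eh]] eXL.
have lin (e' : mor X X) :
    exists psi : mor T T, fac (eq L) (h \oc e' - psi \oc h).
  have [U' [g [w [UU' d]]]] := eh.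
  have ext Y (x : mor U' Y) : fac (eq L) x ->
      exists2 y : mor X Y, fac (eq L) y & x = y \oc g.
    elim=> [|A a b {}x LA _ [y Fy ->]].
      by exists 0; rewrite ?comp0l //; apply: Fac0.
    subst A; have [a' ->] := dist_ext_shift d (TL (shm a \oc w)).
    by exists (b \oc a' + y); [apply: FacS | rewrite compDl compmA].
  (* On U' the map factors through add L by hypothesis, and the factorization extends to [X] because
     Hom(T, L[1]) = 0. *)
  have [|l Fl lE] := ext T (h \oc e' \oc g).
    rewrite -[_ \oc g]comp_idr; elim: UU' => [|A a b f UA _ IH].
      by rewrite comp0r; apply: Fac0.
    subst A; rewrite compDr compmA; apply: facD => //; apply: fac_compr.
    exact: UTL.
  have [|psi psiE] := dist_ext (x := h \oc e' - l) d.
    by rewrite compBl lE subrr.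
  by exists psi; rewrite -psiE opprB addrC subrK.
have step (e' : mor X X) psi : e' \oc e' = e' -> is_iso psi ->
    fac (eq L) (h \oc e' - psi \oc h) -> fac (either U XL) (idm X - e').
  move=> ee' [psi' [psi'K _]] Fl.
  have [f fE] := ext_tri_lift (psi' \oc h) eh XU.
  have : fac (either U XL) (f \oc e' - idm X).
    apply: (ext_tri_fac (Q := eq L) eh XU); first by left.
      by move=> _ <-; exists XL => //; right.
    have -> : h \oc (f \oc e' - idm X) = psi' \oc (h \oc e' - psi \oc h).
      by rewrite !compBr !compmA -fE psi'K comp_idl comp_idr.
    exact: fac_compl.
  (* Multiplying f e' - 1 on the right by 1 - e' kills the first term and leaves -(1 - e'). *)
  move/(fac_compr (idm X - e')).
  rewrite compBr comp_idr compBl -compmA ee' comp_idl opprB addrC addrA subrK.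
  by move/facN; rewrite opprB.
move=> ee; have [psi Fl] := lin e.
case: (classic (is_iso psi)) => [Ipsi|Npsi]; first by right; apply: step Fl.
have ee' : (idm X - e) \oc (idm X - e) = idm X - e.
  by rewrite compBl !compBr !comp_idl comp_idr ee subrr subr0.
case: (classic (is_iso (idm T - psi))) => [Ipsi|Npsi'].
  left; rewrite -[e](subKr (idm X)); apply: step ee' Ipsi _.
  rewrite compBr comp_idr compBl comp_idl.
  rewrite (_ : _ - _ = - (h \oc e - psi \oc h)); first exact: facN.
  by rewrite !opprB addrC addrA subrK.
case: (Tl _ _ Npsi Npsi'); rewrite addrC subrK; exact: is_iso_id.
Qed.

(** The composite X -> T -> M0 ends in add L after [phi], so it lies in the ideal of U and [XL].
    Retracting M0 onto [T] puts [h] in this ideal too, and then the identity of [X], since U and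
    [XL] are universal extensions of themselves. *)
Lemma adds_of_resolution U L T X XL M0 M1 (phi : mor M0 M1) :
  hom_vanishes U (sh U) -> univ_ext U T X -> univ_ext U L XL ->
  ext_tri U phi -> adds (eq L) M1 -> retract T M0 -> adds (either U XL) X.
Proof.
move=> UU eX eXL ephi LM1 [m [p pm]]; have [XU [h eh]] := eX.
have Fmh : fac (either U XL) (m \oc h).
  apply: (ext_tri_fac (Q := eq L) ephi XU); first by left.
    by move=> _ <-; exists XL => //; right.
  by apply: adds_fac_r LM1.
apply: (ext_tri_fac (Q := either U XL) eh XU); first by left.
  move=> A [] <-; [exists U; first by left | exists XL; first by right].
    exact: univ_ext_id.
  by apply: univ_ext_id; have [] := eXL.
by rewrite comp_idr -[h]comp_idl -pm -compmA; apply: fac_compl.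
Qed.

(** The idempotent of [W1] is not in the ideal, so its complement is. The identity of [W2] is a sum
    of a map through that complement and a map through [W1]; the second cannot be invertible. *)
Lemma idempotent_local_adds Q X W1 W2 :
  (forall e : mor X X, e \oc e = e -> fac Q e \/ fac Q (idm X - e)) ->
  local_end W1 -> local_end W2 -> retract W1 X -> retract W2 X ->
  ~ isomorphic W1 W2 -> ~ adds Q W1 -> adds Q W2.
Proof.
move=> idem W1l W2l [i1 [p1 pi1]] [i2 [p2 pi2]] W12 W1Q.
have [|Fe|F1e] := idem (i1 \oc p1).
- by rewrite compmA -(compmA i1) pi1 comp_idr.
- case: W1Q; have := fac_compl p1 (fac_compr i1 Fe).
  by rewrite -compmA pi1 comp_idr pi1.
have idE : p2 \oc (idm X - i1 \oc p1) \oc i2 + p2 \oc i1 \oc (p1 \oc i2) =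
    idm W2.
  by rewrite compBr compBl comp_idr pi2 !compmA subrK.
case: (classic (is_iso (p2 \oc (idm X - i1 \oc p1) \oc i2))) =>
  [[s [sE _]]|N1].
  by rewrite /adds -sE; apply/fac_compl/fac_compr/fac_compl.
case: (classic (is_iso (p2 \oc i1 \oc (p1 \oc i2)))) => [[s [sE _]]|N2].
  case: W12; apply/isomorphic_sym.
  apply: indecomposable_retract (local_indecomposable W1l) W2l.1 _.
  by exists (p1 \oc i2), (s \oc (p2 \oc i1)); rewrite -compmA.
by case: (W2l.2 _ _ N1 N2); rewrite idE; apply: is_iso_id.
Qed.

Lemma adds_fac_to Q Q' X Y (f : mor X Y) :
  (forall A, Q A -> forall g : mor X A, fac Q' g) -> adds Q Y -> fac Q' f.
Proof.
move=> QX QY; rewrite -[f]comp_idl; elim: QY => [|A a b g QA _ IH].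
  by rewrite comp0l; apply: Fac0.
by rewrite compDl -compmA; apply: facD => //; apply: fac_compl; apply: QX.
Qed.

Lemma left_mutation_univ_ext n (Mi : 'I_n -> D) k M N : basic_decomp Mi M ->
  presilting M -> left_mutation_at Mi k N ->
  exists L Z, [/\ complement M L (Mi k), univ_ext L (sh (Mi k)) Z &
    [/\ basic N, adds (either L Z) N, adds (eq N) L & adds (eq N) Z]].
Proof.
move=> Mb Mpre [L [L' [Z [E [f [g [h [Ls [fa _] d LZE EN]]]]]]]].
have c := basic_complement Mb Ls.
exists L, Z; split=> //; last exact/(flat_dsum2P _ LZE).
apply: left_approx_univ_ext fa d.
apply: hom_vanishes_adds_l (compl_l c) => _ <-.
by apply: hom_vanishes_adds_r (adds_sh1 (compl_l c)) => _ <-; apply: (Mpre 1%N).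
Qed.

(** * Left mutation as a universal extension of X[1] by L *)

Section Mutation.
Variables (M L X Z N : D).
Hypotheses (M_silting : silting M) (MLX : complement M L X).
Hypothesis Z_ext : univ_ext L (sh X) Z.
Hypotheses (N_LZ : adds (either L Z) N) (N_L : adds (eq N) L).
Hypothesis N_Z : adds (eq N) Z.

Let MM A B : adds (eq M) A -> adds (eq M) B -> hvan 1 A B.
Proof.
by move=> MA MB; apply: (hvan_adds _ MA MB) => _ _ <- <-; apply: M_silting.1.
Qed.
Let LL : hvan 1 L L. Proof. by apply: MM; apply: compl_l MLX. Qed.
Let XX : hvan 1 (sh X) (sh X).
Proof. by apply/hvan_shr/hvan_shl/MM; apply: compl_r MLX. Qed.
Let LX : hvan 1 L (sh X).
Proof.
apply/hvan_shr/(hvanW (m := 1)) => //.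
by apply: MM; [apply: compl_l MLX | apply: compl_r MLX].
Qed.
Let XL : hvan 2 (sh X) L.
Proof. by apply/hvan_shl/MM; [apply: compl_r MLX | apply: compl_l MLX]. Qed.

Lemma mutation_silting : silting N.
Proof.
apply: (univ_ext_silting Z_ext LL XX LX XL N_LZ N_L N_Z) => P tP PL PX Y.
apply: (M_silting.2 Y P tP).
apply: (thick_adds tP) (compl_gen MLX) => _ [] <- //.
exact: (thick_sh tP X).2 PX.
Qed.

Lemma hvan_mutation W : hvan 1 W M -> hvan 1 W N.
Proof.
move=> WM.
have WL : hvan 1 W L by apply: hvan_adds_r (compl_l MLX) => _ <-.
have WX : hvan 1 W X by apply: hvan_adds_r (compl_r MLX) => _ <-.
have [L' LL' t] := univ_ext_tri Z_ext.
apply: hvan_adds_r N_LZ => _ [] <- //; apply: hvan_mid_r t _ _.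
  by apply: hvan_adds_r LL' => _ <-.
by apply/hvan_shr; apply: hvanW WX.
Qed.

(** A map from [W] to [Z] dies in X[1] because Hom(W, X[1]) = 0, so it comes from add L. *)
Lemma fac_mutation W (f : mor W N) : hvan 1 W M -> fac (eq L) f.
Proof.
move=> WM; apply: adds_fac_to N_LZ => _ [] <- g.
  by apply: adds_fac_r; apply: adds_self.
have [_ [h eh]] := Z_ext; apply: ext_tri_ker eh _.
have WX : hom_vanishes W (sh X).
  apply: hom_vanishes_adds_r (adds_sh1 (compl_r MLX)) => _ <-.
  exact: (WM 1%N).
exact: WX.
Qed.

End Mutation.

End Reduction.

(** * Comparison of the completions of a silting object and its mutation *)

Section Main.
Variables (K : fieldType) (D : triCategory K).
Hypothesis KS : krull_schmidt D.
Implicit Types (A B L M N S T U X Z : D).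

Lemma univ_ext_mono U T T' X X' B : univ_ext U T X -> univ_ext U T' X' ->
  adds (eq T') T -> adds (eq B) U -> adds (eq B) X' -> adds (eq B) X.
Proof.
move=> eX eX' T'T BU BX'.
apply: (adds_trans (Q := either U X')) => [_ [] <- //|].
by apply: univ_ext_adds eX _ T'T _ => [|_ <-]; [left | exists X' => //; right].
Qed.

Lemma Bminus_left_mutation S U M N BM BN : hvan 1 S S ->
  presilting U -> two_term S U -> silting M -> two_term S M ->
  left_mutation M N -> two_term S N -> hvan 1 U M ->
  is_Bminus U M BM -> is_Bminus U N BN ->
  isomorphic BN BM \/ left_mutation BM BN.
Proof.
move=> SS Upre U2 sM M2 [_ [n [Mi [Mb [k kN]]]]] N2 UM hBM hBN.
have [L [Z [c eZ [bN N_LZ N_L N_Z]]]] := left_mutation_univ_ext KS Mb sM.1 kN.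
have sN := mutation_silting sM c eZ N_LZ N_L N_Z.
have UN : hvan 1 U N := hvan_mutation c eZ N_LZ UM.
have [bBM sBM BM2] := Bminus_silting KS SS Upre U2 sM M2 UM hBM.
have [bBN sBN BN2] := Bminus_silting KS SS Upre U2 sN N2 UN hBN.
have [XM eXM [_ BM_UX BM_U BM_X]] := Bminus_univ_ext KS Upre hBM.
have [XN eXN [_ BN_UX BN_U BN_X]] := Bminus_univ_ext KS Upre hBN.
have UU1 : hom_vanishes U (sh U) by apply: (Upre 1%N).
have [XL eXL] := ex_univ_ext L UU1; have [Xk eXk] := ex_univ_ext (Mi k) UU1.
pose P := either U XL.
have BM_XL := univ_ext_mono eXL eXM (compl_l c) BM_U BM_X.
have BM_Xk := univ_ext_mono eXk eXM (compl_r c) BM_U BM_X.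
have BN_XL := univ_ext_mono eXL eXN N_L BN_U BN_X.
have BM_gen : adds (fun A => P A \/ Xk = A) BM.
  apply: adds_trans BM_UX => _ [] <-; first by apply: adds_self; left; left.
  apply: (univ_ext_adds eXM _ (compl_gen c)); first by left; left.
  move=> _ [] <-; [exists XL => //; by left; right | by exists Xk => //; right].
have MU2 : hvan 2 M U := hvan2_two_term SS M2 U2.
have idem (e : mor Xk Xk) : e \oc e = e -> fac P e \/ fac P (idm Xk - e).
  have [UX|[M0 [M1 [phi [ephi LM1 XM0]]]]] :=
    resolution_dichotomy KS sM c Upre UM MU2.
    apply: idempotent_dichotomy (compl_local c) _ UX eXk eXL.
    apply: hom_vanishes_adds_l (compl_r c) => _ <-.
    apply: hom_vanishes_adds_r (adds_sh1 (compl_l c)) => _ <-.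
    exact: (sM.1 1%N).
  move=> _; left; apply: adds_fac_l.
  exact: adds_of_resolution UU1 eXk eXL ephi LM1 XM0.
have [_ _ XM_M _] := univ_ext_hvan eXM Upre sM.1 UM MU2.
have BM_M : hvan 1 BM M by apply: hvan_adds_l BM_UX => _ [] <-.
have BM_N : hvan 1 BM N := hvan_mutation c eZ N_LZ BM_M.
have BMBM A B : adds (eq BM) A -> adds (eq BM) B -> hvan 1 A B.
  by move=> BA BB; apply: (hvan_adds _ BA BB) => _ _ <- <-; apply: sBM.1.
have BNBN A B : adds (eq BN) A -> adds (eq BN) B -> hvan 1 A B.
  by move=> BA BB; apply: (hvan_adds _ BA BB) => _ _ <- <-; apply: sBN.1.
have BM_self : adds (eq BM) BM by apply: adds_self.
have BN_self : adds (eq BN) BN by apply: adds_self.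
have BM_BN : hvan 1 BM BN.
  have BMU := BMBM _ _ BM_self BM_U.
  apply: hvan_adds_r BN_UX => _ [] <- //; have [U' UU' t] := univ_ext_tri eXN.
  by apply: hvan_mid_r t _ BM_N; apply: hvan_adds_r UU' => _ <-.
have [m [Bi Bb]] := bBM; have [Bii Bn Bs] := Bb.
have P_BN A : adds P A -> adds (eq BN) A.
  by apply: adds_trans => _ [] <-.
(* If every summand of [BM] lies in add P, then [BM] is in add BN and maximality gives equality.
   Otherwise a summand outside add P is the one to mutate at. *)
case: (classic (forall i, adds P (Bi i))) => [PBi|/not_all_ex_not [j Pj]].
  have BN_BM : adds (eq BN) BM by apply: P_BN; apply: dsum_adds Bs PBi.
  left; apply: (basic_iso KS) => //; apply: silting_max => //.
  exact: BNBN.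
right; split=> //; exists m, Bi; split=> //; exists j.
have [LB LBs] := ex_dsum (fun i : {i : 'I_m | i != j} => Bi (val i)).
have cB := basic_complement KS Bb LBs.
have [L' [f [fa fm]]] := ex_min_left_approx LB (Bi j).
have [ZB [g [h d]]] := dist_cone f; have [EB EBs] := ex_dsum2 LB ZB.
have BM_LB := compl_l cB; have BM_Bj := compl_r cB; have Bjl := compl_local cB.
have LB1 : hom_vanishes LB (sh LB) by apply: (BMBM _ _ BM_LB BM_LB 1%N).
have eZB := left_approx_univ_ext LB1 fa d.
have EB_gen : adds (either LB ZB) EB.
  by apply: (dsum2_adds EBs); apply: adds_self; [left | right].
have EB_L := retract_adds1 (dsum2_retract_l EBs).
have EB_Z := retract_adds1 (dsum2_retract_r EBs).
have sEB := mutation_silting sBM cB eZB EB_gen EB_L EB_Z.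
have Bil i : local_end (Bi i) by apply: (indecomposable_local KS).
have BiXk i : ~ adds P (Bi i) -> retract (Bi i) Xk.
  move=> Pi; have BiBM := retract_adds (dsum_retract i Bs) BM_gen.
  have [A [[PA|<-] rA]] := local_adds (Bil i) BiBM; last by [].
  by case: Pi; apply: retract_adds rA (adds_self PA).
(* A second summand outside add P would, like [Bi j], be a summand of [Xk], against the dichotomy
   for idempotents of [Xk]. *)
have P_LB : adds P LB.
  apply: (dsum_adds LBs) => -[i /= ij].
  case: (classic (adds P (Bi i))) => // Pi.
  apply: (idempotent_local_adds idem (Bil j) (Bil i) (BiXk j Pj)) => //.
    exact: BiXk.
  by apply: Bn; rewrite eq_sym.
have LB_P A : P A -> adds (eq LB) A.
  move=> PA; apply: (adds_local KS) => W Wl WA.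
  have [|/isomorphic_sym/isomorphic_retract WBj|//] := compl_or cB Wl _.
    by apply: retract_adds WA _; case: PA => <-.
  by case: Pj; apply: retract_adds (retract_trans WBj WA) (adds_self PA).
have BN_LB := P_BN LB P_LB.
have BN_L' : adds (eq BN) L'.
  by apply: adds_trans (in_add_adds fa.1) => _ <-.
have BjU : hom_vanishes (Bi j) (sh U) by apply: (BMBM _ _ BM_Bj BM_U 1%N).
have Bj_M : hvan 1 (Bi j) M by apply: hvan_adds_l BM_Bj => _ <-.
have Bj_BN : hvan 1 (Bi j) BN by apply: hvan_adds_l BM_Bj => _ <-.
(* Pushed down to [N], a map from [Bi j] to [XN] factors through add L, because [Bi j] has no
   positive extensions to [M]. Lifting back replaces [L] by [XL], which is in add LB. *)
have fac_BN (x : mor (Bi j) BN) : fac (eq LB) x.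
  apply: (fac_trans LB_P); apply: adds_fac_to BN_UX => _ [] <- y.
    by apply: adds_fac_r; apply: adds_self; left.
  have [_ [hN ehN]] := eXN; apply: (ext_tri_fac (Q := eq L) ehN BjU).
  - by left.
  - by move=> _ <-; exists XL => //; right.
  - exact: (fac_mutation c eZ N_LZ).
have t : tri L' ZB (sh (Bi j)) by exists g, h, (- shm f); apply: dist_rot1.
have EB_BN : hvan 1 EB BN.
  apply: hvan_adds_l EB_gen => _ [] <-; first exact: BNBN.
  case=> // -[_|i _]; last first.
    apply: (hvan_mid_l (m := 2) t) => //; last exact/hvan_shl.
    by apply: (hvanW (m := 1)) => //; apply: BNBN.
  have L'BN : hom_vanishes L' (sh BN).
    exact: (BNBN _ _ BN_L' BN_self 1%N).
  (* The map vanishes on L', so it comes from the shift of a map from [Bi j] to [BN]. This factors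
     through add LB, and Hom(ZB, LB[1]) = 0. *)
  move=> z.
  have [y ->] := dist_ext (dist_rot1 d) (L'BN (z \oc g)).
  have [x <-] := shm_surj y.
  apply: comp_fac0_r (fac_shm (fac_BN x)) => _ [_ <- <-].
  exact: eZB.1.
have BN_EB : hvan 1 BN EB.
  apply: hvan_adds_r EB_gen => _ [] <-; first exact: BNBN.
  apply: hvan_mid_r t _ _; first exact: BNBN.
  (* The remaining end of the triangle is the shift of [Bi j], so only degrees at least 2 between
     objects of S * S[1] occur. *)
  apply/hvan_shr; apply: (hvan2_two_term SS BN2).
  by apply: (two_term_adds SS) BM_Bj => _ <-.
exists LB, L', ZB, EB, f, g, h; split=> //; apply/(flatP KS); split=> //.
  exact: silting_max.
exact: silting_max.
Qed.

End Main.

Theorem theorem4p5 (K : fieldType) (D : triCategory K)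
    (KS : krull_schmidt D)
    (n : nat) (S : D) (Si : 'I_n -> D)
    (S_basic : basic_decomp Si S) (S_silting : silting S)
    (U : D) (U_basic : basic U) (U_presilting : presilting U)
    (U_in_C : two_term S U)
    (M : D) (Mi : 'I_n -> D)
    (M_basic : basic_decomp Mi M) (M_silting : silting M)
    (M_in_C : two_term S M)
    (N : D) (N_mutation : left_mutation M N) (N_in_C : two_term S N) :
  ((forall i : nat, (0 < i)%N -> hom_vanishes U (shn i M)) <->
     hom_vanishes U (shn 1 M)) /\
  ((forall i : nat, (0 < i)%N -> hom_vanishes U (shn i M)) ->
   [/\ forall i : nat, (0 < i)%N -> hom_vanishes U (shn i N),
       [/\ exists B : D, is_Bminus U M B,
           forall B : D, is_Bminus U M B -> basic_silting_in S B,
           exists B : D, is_Bminus U N B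
         & forall B : D, is_Bminus U N B -> basic_silting_in S B]
     & forall BM BN : D, is_Bminus U M BM -> is_Bminus U N BN ->
         isomorphic BN BM \/ left_mutation BM BN]).
Proof.
have SS : hvan 1 S S := S_silting.1.
split.
  split=> [UM|UM [//|[_|i _]]]; first exact: UM; first exact: UM.
  (* Between objects of S * S[1], all degrees from 2 on vanish, so degree 1 decides. *)
  exact: (hvan2_two_term SS U_in_C M_in_C).
move=> UM; have [_ [m [Mi' [Mb [k kN]]]]] := N_mutation.
have [L [Z [c eZ [_ N_LZ N_L N_Z]]]] :=
  left_mutation_univ_ext KS Mb M_silting.1 kN.
have sN := mutation_silting M_silting c eZ N_LZ N_L N_Z.
have UN : hvan 1 U N := hvan_mutation c eZ N_LZ UM.
split=> //.
  split; try exact: (ex_Bminus KS).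
    move=> B.
    exact: (Bminus_silting KS SS U_presilting U_in_C M_silting M_in_C UM).
  by move=> B; apply: (Bminus_silting KS SS U_presilting U_in_C sN N_in_C UN).
move=> BM BN; exact: (Bminus_left_mutation KS SS U_presilting U_in_C M_silting).
Qed.
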